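(* Let $\mathcal L=\{Y_n\}=\{(X_n,J_n)\}$ be a $d$-dimensional skip-free semi-irreducible MMRRW each of whose induced Markov chains $\mathcal L^A$ ($\emptyset\ne A\subset D$) is either semi-irreducible and stable, or transient. For any $\varepsilon>0$ and any $\delta\in(0,1)$, there exist a set of positive integers $\{(K_A,u_A): A\in\mathcal P(D), A\neq\emptyset\}$ satisfying $u_A<K_A$ for all nonempty $A$ and $K_A<K_B$ whenever $|A|>|B|$ ($A,B$ nonempty), and a set of nonnegative vectors $\{(p^{A,B}_y)_{B\in\mathcal D^A_{stable}}: A\in\mathcal P(D), A\neq\emptyset, y\in\mathcal V_A\}$ such that, for all nonempty $A\in\mathcal P(D)$ and all $y\in\mathcal V_A$, $$\delta<\sum_{B\in\mathcal D^A_{stable}}p^{A,B}_y\le1,\qquad \Big|\tilde\alpha_y(l)/u_A-\sum_{B\in\mathcal D^A_{stable}}p^{A,B}_y\,a^{A\cup B}(l)\Big|<\varepsilon\quad\text{for all }l\in D,$$ where, if the induced Markov chain $\mathcal L^A$ is stable, the last expression simplifies to $|\tilde\alpha_y(l)/u_A-a^A(l)|<\varepsilon$ for all $l\in D$.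
   Context: Notation: $D=\{1,\dots,d\}$; $\mathcal P(A)$ is the set of all subsets of $A$ (including $\emptyset$); for $x\in\mathbb R^d$, $x(l)$ is the $l$-th coordinate and $x(A)=(x(l))_{l\in A}$; relations between a vector and a number, such as $x(A)>0$, hold coordinatewise (vacuously if $A=\emptyset$). For $A\in\mathcal P(D)$ let $\mathcal B^A=\{x\in\mathbb R_+^d: x(A)>0,\ x(D\setminus A)=0\}$ and let $S^A=\{1,\dots,s^A\}$ be a nonempty finite set. MMRRW. A $d$-dimensional skip-free Markov modulated reflecting random walk (MMRRW) $\mathcal L=\{Y_n\}=\{(X_n,J_n)\}$ is a discrete-time homogeneous Markov chain on $\mathcal S=\bigcup_{A\in\mathcal P(D)}(\mathcal B^A\cap\mathbb Z^d)\times S^A$ such that $X_{n+1}-X_n\in\{-1,0,1\}^d$ and, whenever $x\in\mathcal B^A\cap\mathbb Z^d$, $z\in\{-1,0,1\}^d$, $x+z\in\mathcal B^B\cap\mathbb Z^d$, $i\in S^A$, $j\in S^B$, the probability $\mathbb P(Y_{n+1}=(x+z,j)\mid Y_n=(x,i))=p_z^{A,B}(i,j)$ depends only on $A,B,z,i,j$. Semi-irreducibility and stability (for any countable-state Markov chain). The chain is semi-irreducible if it has exactly one irreducible (closed communicating) class $\mathcal S_0$ and every state of $\mathcal S_0$ is accessible from every state. A semi-irreducible chain is stable if $\mathcal S_0$ is positive recurrent and from every state outside $\mathcal S_0$ the first passage time to $\mathcal S_0$ is a.s. finite with finite expectation. Expanded and induced chains. Let $\emptyset\ne A\in\mathcal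 P(D)$. For $B\in\mathcal P(D\setminus A)$ let $\hat{\mathcal B}^{A,B}=\{x\in\mathbb R^d: x(B)>0,\ x(D\setminus(A\cup B))=0\}$ ($x(A)$ arbitrary). The expanded chain $\hat{\mathcal L}^A=\{Y^A_n\}=\{(X^A_n,J^A_n)\}$ is the Markov chain on $\hat{\mathcal S}^A=\bigcup_{B\in\mathcal P(D\setminus A)}(\hat{\mathcal B}^{A,B}\cap\mathbb Z^d)\times S^{A\cup B}$ with $\mathbb P(Y^A_{n+1}=(x+z,j)\mid Y^A_n=(x,i))=p_z^{A\cup B,A\cup C}(i,j)$ for $x\in\hat{\mathcal B}^{A,B}\cap\mathbb Z^d$, $z\in\{-1,0,1\}^d$, $x+z\in\hat{\mathcal B}^{A,C}\cap\mathbb Z^d$, $i\in S^{A\cup B}$, $j\in S^{A\cup C}$. The process $\mathcal L^A=\{(X^A_n(D\setminus A),J^A_n)\}$ is itself a Markov chain (a $(d-|A|)$-dimensional MMRRW; a finite chain if $A=D$), called the induced Markov chain with index $A$. ''$\mathcal L^A$ is transient'' means that all its states are transient (semi-irreducibility not required). $\mathcal D_{stable}$ is the set of nonempty $A\in\mathcal P(D)$ such that $\mathcal L^A$ is semi-irreducible and stable (always $D\in\mathcal D_{stable}$). For $A\in\mathcal D_{stable}$ the mean drift vector is $a^A=\lim_{n\to\infty}\frac1n(X^A_n-X^A_0)\in\mathbb R^d$ (a.s. limit, nonrandom); equivalently, it is the expectation of the one-step conditional mean increment vector of $X^A$ under the stationary distribution of $\mathcal L^A$. For nonempty $A$, $\mathcal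 D^A_{stable}=\{B\in\mathcal P(D\setminus A): A\cup B\in\mathcal D_{stable}\}$. Partition and embedded chain. Given $\{(K_A,u_A)\}$ as in the claim, $\mathcal V_A$ ($A\in\mathcal P(D)$) is the set of $(x,j)\in\mathcal S$ with $x(A)\ge K_A$ (no condition if $A=\emptyset$) for which there is no $C\in\mathcal P(D)$ with $|C|>|A|$ and $x(C)\ge K_C$; these sets partition $\mathcal S$. Put $u(y)=u_A$ if $y\in\mathcal V_A$ with $A\neq\emptyset$, and $u(y)=1$ if $y\in\mathcal V_\emptyset$; $\sigma_0=0$, $\sigma_{n+1}=\sigma_n+u(Y_{\sigma_n})$; the embedded chain is $\tilde Y_n=(\tilde X_n,\tilde J_n)=Y_{\sigma_n}$. Its conditional mean increment vector is $\tilde\alpha_y=\mathbb E(\tilde X_1-\tilde X_0\mid\tilde Y_0=y)=\mathbb E(X_{u(y)}-X_0\mid Y_0=y)$. *)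

(* Defs.v *)
From HB Require Import structures.
From mathcomp Require Import all_boot all_order all_algebra.
From mathcomp Require Import all_classical all_reals all_analysis.
Set Implicit Arguments.
Unset Strict Implicit.
Unset Printing Implicit Defensive.
Import Order.TTheory GRing.Theory Num.Theory.
Import numFieldNormedType.Exports.
Local Open Scope classical_set_scope.
Local Open Scope ring_scope.

(** * Markov chains on a countable state space, given by their one-step
      transition probabilities *)

Section CountableChains.
Variables (R : realType) (S : countType) (P : S -> S -> R).

Fixpoint nstep (n : nat) (x y : S) : \bar R :=
  if n is n'.+1 then (\esum_(z in [set: S]) ((P x z)%:E * nstep n' z y))%E
  else ((x == y)%:R)%:E.

Definition accessible (x y : S) : Prop := exists n, (0 < nstep n x y)%E.

Definition closed_class (C : set S) : Prop :=
  [/\ C !=set0,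
      forall x y, C x -> C y -> accessible x y &
      forall x y, C x -> accessible x y -> C y].

Definition semi_irreducible : Prop :=
  (exists! C, closed_class C) /\
  (forall C, closed_class C -> forall x y, C y -> accessible x y).

(* [survival C n x] is the probability, starting from [x], that
   tau_C := inf {m >= 1 | Y_m \in C} exceeds [n]. *)
Fixpoint survival (C : set S) (n : nat) (x : S) : \bar R :=
  if n is n'.+1 then (\esum_(z in ~` C) ((P x z)%:E * survival C n' z))%E
  else 1%E.

Definition passage_finite (C : set S) (x : S) : Prop :=
  survival C n x @[n --> \oo] --> (0%E : \bar R).

(* E_x[tau_C] = \sum_n P_x(tau_C > n) *)
Definition mean_passage (C : set S) (x : S) : \bar R :=
  (\sum_(0 <= n <oo) survival C n x)%E.

Definition recurrent (x : S) : Prop := passage_finite [set x] x.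
Definition transient (x : S) : Prop := ~ recurrent x.
Definition positive_recurrent (x : S) : Prop :=
  recurrent x /\ (mean_passage [set x] x < +oo)%E.

Definition stable : Prop :=
  semi_irreducible /\
  forall C, closed_class C ->
    (forall x, C x -> positive_recurrent x) /\
    (forall x, ~ C x -> passage_finite C x /\ (mean_passage C x < +oo)%E).

(* [Y] is a Markov chain with transition probabilities [P] and arbitrary
   initial distribution. *)
Definition markov_chain d (Omega : measurableType d) (Pr : probability Omega R)
    (Y : nat -> Omega -> S) : Prop :=
  (forall n y, measurable (Y n @^-1` [set y])) /\
  (forall n (h : nat -> S),
    Pr [set w | forall k, (k <= n.+1)%N -> Y k w = h k] =
    (Pr [set w | forall k, (k <= n)%N -> Y k w = h k]
      * (P (h n) (h n.+1))%:E)%E).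

End CountableChains.

(** * State spaces and transition probabilities

   The phase set S^A is {0, ..., s A - 1}.  A pair (x, j) is a position and a
   phase.  The expanded chain with index A has x(A) unrestricted; for A = set0
   its state space and transition probabilities are those of the reflecting
   random walk itself. *)

Definition site (d : nat) : Type := ({ffun 'I_d -> int} * nat)%type.

(* A :|: B for x in \hat{B}^{A,B} *)
Definition face d (A : {set 'I_d}) (x : {ffun 'I_d -> int}) : {set 'I_d} :=
  A :|: [set l | 0 < x l]%SET.

Definition valid d (s : {set 'I_d} -> nat) (A : {set 'I_d}) (y : site d)
    : bool :=
  [forall l, (l \notin A) ==> (0 <= y.1 l)] && (y.2 < s (face A y.1))%N.

Definition state d (s : {set 'I_d} -> nat) (A : {set 'I_d}) : Type :=
  {y : site d | valid s A y}.

(* The induced chain lives on Z_+^{D \ A}, encoded as the x with x(A) = 0. *)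
Definition induced_state d (s : {set 'I_d} -> nat) (A : {set 'I_d}) : Type :=
  {y : site d | valid s A y && [forall l in A, y.1 l == 0]}.

(* [p B C z i j] stands for p_z^{B,C}(i,j). *)
Definition transition (R : realType) d
    (p : {set 'I_d} -> {set 'I_d} -> {ffun 'I_d -> int} -> nat -> nat -> R)
    (A : {set 'I_d}) (y y' : site d) : R :=
  if [forall l, `|y'.1 l - y.1 l| <= 1]
  then p (face A y.1) (face A y'.1) [ffun l => y'.1 l - y.1 l] y.2 y'.2
  else 0.

(* Values of [prob] other than the p_z^{A,B}(i,j) occurring in a transition
   are irrelevant. *)
Record mmrrw (R : realType) (d : nat) := MMRRW {
  nphase : {set 'I_d} -> nat;
  nphase_gt0 : forall A, (0 < nphase A)%N;
  prob : {set 'I_d} -> {set 'I_d} -> {ffun 'I_d -> int} -> nat -> nat -> R;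
  prob_ge0 : forall A B z i j, 0 <= prob A B z i j;
  prob_sum1 : forall y : state nphase finset.set0,
    (\esum_(y' in [set: state nphase finset.set0])
       (transition prob finset.set0 (val y) (val y'))%:E = 1)%E
}.

Section Chains.
Variables (R : realType) (d : nat) (L : mmrrw R d).

Definition expanded_chain (A : {set 'I_d}) (y y' : state (nphase L) A) : R :=
  transition (prob L) A (val y) (val y').

Definition walk_state : Type := state (nphase L) finset.set0.

Definition walk_chain (y y' : walk_state) : R := expanded_chain y y'.

Definition forget (A : {set 'I_d}) (y : site d) : site d :=
  ([ffun l => if l \in A then 0 else y.1 l], y.2).

(* Transition probabilities of (X^A(D \ A), J^A); the sum has finite support
   since the chain is skip-free. *)
Definition induced_chain (A : {set 'I_d}) (v v' : induced_state (nphase L) A) : R :=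
  \sum_(y' \in [set y' : state (nphase L) A | forget A (val y') = val v'])
     transition (prob L) A (val v) (val y').

Definition Dstable (A : {set 'I_d}) : Prop :=
  A != finset.set0 /\ stable (@induced_chain A).

Definition DstableR (A B : {set 'I_d}) : Prop :=
  (B \subset ~: A)%SET /\ Dstable (A :|: B)%SET.

(* [a] is the nonrandom a.s. limit of (X^A_n - X^A_0) / n, whatever the initial
   distribution. *)
Definition is_mean_drift (A : {set 'I_d}) (a : 'I_d -> R) : Prop :=
  forall (disp : measure_display) (Omega : measurableType disp)
    (Pr : probability Omega R) (Y : nat -> Omega -> state (nphase L) A),
  markov_chain (@expanded_chain A) Pr Y ->
  {ae Pr, forall w, forall l,
    (((val (Y n w)).1 l - (val (Y 0%N w)).1 l)%:~R / n%:R : R)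
      @[n --> \oo] --> a l}.

Section Partition.
Variables (K u : {set 'I_d} -> nat).

Definition above (A : {set 'I_d}) (y : walk_state) : bool :=
  [forall l in A, (K A)%:Z <= (val y).1 l].

Definition region (A : {set 'I_d}) : {pred walk_state} :=
  fun y => above A y &&
    [forall C : {set 'I_d}, (#|A| < #|C|)%N ==> ~~ above C y].

(* When the K_A are as in the theorem, the regions partition the state space and
   the choice of A is unique. *)
Definition sojourn (y : walk_state) : nat :=
  if [pick A : {set 'I_d} | (A != finset.set0) && (y \in region A)] is Some A
  then u A else 1%N.

Definition embedded (y y' : walk_state) : \bar R := nstep walk_chain (sojourn y) y y'.

(* Expectation of \tilde X_1 - \tilde X_0 given \tilde Y_0 = y; the sum has
   finite support since the chain is skip-free. *)
Definition mean_increment (y : walk_state) (l : 'I_d) : R :=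
  \sum_(y' \in [set: walk_state])
    fine (embedded y y') * ((val y').1 l - (val y).1 l)%:~R.

End Partition.
End Chains.

(* Main.v *)
(* Proof idea.  All thresholds depend on #|A| only and are built from #|A| = d
   downwards: first u, then K above u and above the later thresholds.

   A start in the region of A has x(A) > u_A, so for u_A steps the walk is the
   expanded chain with index A; moreover x(l) < K_(#|A|+1) for l outside A, so
   up to translations in x(A) there are finitely many starting points, and it is
   enough to treat each of them for large times.

   If the induced chain is stable, the mean displacement per unit time tends to
   a^A: realize the expanded chain on [0,1[ and apply dominated convergence to
   the almost sure limit that defines a^A.

   If it is transient, the expected time spent where all coordinates outside A
   are low is bounded by a constant, by decomposing at the last visit.  At any
   other site some larger B has x(B \ A) above its threshold, and the estimate
   already known for B governs the next u_B steps.  Cutting [0, n] into such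
   blocks writes the mean displacement as a mixture of drifts a^E, up to an error
   that is a small multiple of n plus a constant. *)

Require Import Defs.
From HB Require Import structures.
From mathcomp Require Import all_boot all_order all_algebra.
From mathcomp Require Import all_classical all_reals all_analysis.
From mathcomp Require Import ring lra zify.
Set Implicit Arguments.
Unset Strict Implicit.
Unset Printing Implicit Defensive.
Import Order.TTheory GRing.Theory Num.Theory.
Import numFieldNormedType.Exports.
Local Open Scope classical_set_scope.
Local Open Scope ring_scope.

(** * Construction of a finitely branching Markov chain *)

Section InverseCdf.
Variables (R : realType) (T : eqType) (f : T -> R).

(** Left endpoint of the piece of length [f y] given to [y] when an interval starting at 0 is cut in
    the order of [r]; an element outside [r] gets the total mass. *)
Definition cdf (r : seq T) (y : T) : R := \sum_(z <- take (index y r) r) f z.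

Hypothesis f_ge0 : forall y, 0 <= f y.

Lemma cdf_ge0 r y : 0 <= cdf r y.
Proof. exact: sumr_ge0. Qed.

Lemma cdf_notin r y : y \notin r -> cdf r y = \sum_(z <- r) f z.
Proof. by move=> yr; rewrite /cdf take_oversize // (memNindex yr). Qed.

Lemma cdf_succ r y : y \in r ->
  cdf r y + f y = \sum_(z <- take (index y r).+1 r) f z.
Proof.
move=> yr; rewrite (take_nth y) ?index_mem// nth_index//.
by rewrite -cats1 big_cat big_seq1.
Qed.

Lemma sum_take_le (r : seq T) i j : (i <= j)%N ->
  \sum_(z <- take i r) f z <= \sum_(z <- take j r) f z.
Proof.
move=> ij; rewrite -(subnKC ij) takeD big_cat lerDl.
exact: sumr_ge0.
Qed.

Lemma cdf_succ_le r y : y \in r -> cdf r y + f y <= \sum_(z <- r) f z.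
Proof.
move=> yr; rewrite cdf_succ// -[X in _ <= \sum_(z <- X) _](take_size r).
by apply: sum_take_le; rewrite index_mem.
Qed.

Lemma cdf_exists r u : uniq r -> 0 <= u < \sum_(z <- r) f z ->
  exists2 y, y \in r & cdf r y <= u < cdf r y + f y.
Proof.
elim: r u => [|x r IH] u /=; first by rewrite big_nil; lra.
move=> /andP[xr ur]; rewrite big_cons => /andP[u0 uS].
have [ux|xu] := ltP u (f x).
  by exists x; rewrite ?mem_head// /cdf /= eqxx take0 big_nil add0r u0 ux.
have [||y yr /andP[h1 h2]] := IH (u - f x); first exact: ur.
  by apply/andP; split; lra.
exists y; first by rewrite inE yr orbT.
have yx : x == y = false by apply/eqP => xy; rewrite xy yr in xr.
by rewrite /cdf /= yx /= big_cons -/(cdf r y); apply/andP; split; lra.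
Qed.

Lemma cdf_unique r u y y' : y \in r -> y' \in r ->
  cdf r y <= u < cdf r y + f y -> cdf r y' <= u < cdf r y' + f y' -> y = y'.
Proof.
move=> yr y'r /andP[h1 h2] /andP[h3 h4].
have [lt|lt|e] := ltngtP (index y r) (index y' r).
- have := sum_take_le r lt; rewrite -cdf_succ// -/(cdf r y').
  by move=> h5; exfalso; lra.
- have := sum_take_le r lt; rewrite -cdf_succ// -/(cdf r y).
  by move=> h5; exfalso; lra.
- by rewrite -(nth_index y yr) e nth_index.
Qed.

End InverseCdf.

Section UniformMeasure.
Variable R : realType.

Definition uniform01 : set (measurableTypeR R) -> \bar R :=
  mrestr (@lebesgue_measure R) (measurable_itv `[(0 : R), 1[).

HB.instance Definition _ := Measure.on uniform01.

Lemma uniform01_setT : uniform01 setT = 1%E.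
Proof.
rewrite /uniform01 /mrestr setTI lebesgue_measure_itv /= lte01.
by rewrite sube0.
Qed.

HB.instance Definition _ :=
  @Measure_isProbability.Build _ _ R uniform01 uniform01_setT.

End UniformMeasure.

Section ChainConstruction.
Variables (R : realType) (S : countType) (P : S -> S -> R) (succ : S -> seq S).
Hypothesis P_ge0 : forall x y, 0 <= P x y.
Hypothesis succ_uniq : forall x, uniq (succ x).
Hypothesis P_notin : forall x y, y \notin succ x -> P x y = 0.
Hypothesis P_sum1 : forall x, \sum_(y <- succ x) P x y = 1.
Variable x0 : S.

Local Notation F x := (cdf (P x) (succ x)).

(** Inverse-cdf sampling; the default [x] can only occur for [u] outside [0, 1[. *)
Definition next (x : S) (u : R) : S :=
  xget x [set y | y \in succ x /\ F x y <= u < F x y + P x y].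

Lemma nextP x u : 0 <= u < 1 ->
  next x u \in succ x /\ F x (next x u) <= u < F x (next x u) + P x (next x u).
Proof.
move=> u01; rewrite /next; case: xgetP => [y _ []//|no].
have [||y yx yu] := @cdf_exists _ _ (P x) (succ x) u.
- exact: succ_uniq.
- by rewrite P_sum1.
- by exfalso; apply: (no y).
Qed.

Lemma cdf_succ_le1 x y : F x y + P x y <= 1.
Proof.
have [yx|yx] := boolP (y \in succ x); first by rewrite -(P_sum1 x) cdf_succ_le.
by rewrite cdf_notin// P_sum1 P_notin// addr0.
Qed.

(** The second component is the position of [u] inside the chosen piece, rescaled to [0, 1[. It
    serves as the next uniform variable, so a single [u] drives the whole trajectory. *)
Definition chain_step (xu : S * R) : S * R :=
  (next xu.1 xu.2, (xu.2 - F xu.1 (next xu.1 xu.2)) / P xu.1 (next xu.1 xu.2)).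

Definition traj (u : R) (n : nat) : S * R := iter n chain_step (x0, u).

Lemma chain_step_unit xu : 0 <= xu.2 < 1 -> 0 <= (chain_step xu).2 < 1.
Proof.
move=> u01; have [_ /andP[h1 h2]] := nextP xu.1 u01.
have p0 : 0 < P xu.1 (next xu.1 xu.2) by lra.
rewrite /chain_step /=; apply/andP; split.
  by rewrite divr_ge0// subr_ge0.
by rewrite ltr_pdivrMr// mul1r ltrBlDl.
Qed.

Lemma traj_unit u n : 0 <= u < 1 -> 0 <= (traj u n).2 < 1.
Proof. by move=> u01; elim: n => // n IH; apply: chain_step_unit. Qed.

Fixpoint path_prob (h : nat -> S) n : R :=
  if n is n'.+1 then path_prob h n' * P (h n') (h n'.+1) else 1.

(** Left endpoint of the interval of those [u] whose trajectory follows [h] up to time [n]; its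
    length is [path_prob h n]. *)
Fixpoint path_inf (h : nat -> S) n : R :=
  if n is n'.+1 then path_inf h n' + path_prob h n' * F (h n') (h n'.+1) else 0.

Lemma path_prob_ge0 h n : 0 <= path_prob h n.
Proof. by elim: n => //= n IH; rewrite mulr_ge0. Qed.

Lemma path_inf_bounds h n : 0 <= path_inf h n /\ path_inf h n + path_prob h n <= 1.
Proof.
elim: n => [|n [IH1 IH2]] /=; first by split; rewrite ?add0r.
split; first by rewrite addr_ge0// mulr_ge0 ?path_prob_ge0// cdf_ge0.
rewrite -addrA -mulrDr (le_trans _ IH2)// lerD2l.
by rewrite ler_piMr ?path_prob_ge0// cdf_succ_le1.
Qed.

(* The points of the unit interval whose trajectory starts with [h 0, ..., h n]
   form an interval, on which the residual variable is the affine coordinate. *)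
Lemma traj_path h n u : h 0%N = x0 -> 0 <= u < 1 ->
  ((forall k, (k <= n)%N -> (traj u k).1 = h k) <->
     path_inf h n <= u < path_inf h n + path_prob h n) /\
  ((forall k, (k <= n)%N -> (traj u k).1 = h k) ->
     u = path_inf h n + path_prob h n * (traj u n).2).
Proof.
move=> h0 u01; elim: n => [|n [IH1 IH2]].
  split; last by move=> _ /=; rewrite add0r mul1r.
  split=> [_|_ k]; first by rewrite /= add0r.
  by rewrite leqn0 => /eqP ->.
have fwd : (forall k, (k <= n.+1)%N -> (traj u k).1 = h k) ->
    path_inf h n.+1 <= u < path_inf h n.+1 + path_prob h n.+1 /\
    u = path_inf h n.+1 + path_prob h n.+1 * (traj u n.+1).2.
  move=> E; have En k : (k <= n)%N -> (traj u k).1 = h k by move=> kn; apply: E; lia.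
  have /andP[a1 a2] := IH1.1 En; have uE := IH2 En.
  have [_] := nextP (traj u n).1 (traj_unit n u01).
  have := E n.+1 (leqnn _); rewrite /= En// => -> /andP[f1 f2].
  have p0 : 0 < P (h n) (h n.+1) by lra.
  have pi0 : 0 < path_prob h n by lra.
  split; last by rewrite {1}uE; field; rewrite gt_eqF.
  rewrite {1 2}uE lerD2l ler_pM2l// f1 /= -addrA ltrD2l -mulrDr.
  by rewrite ltr_pM2l.
split; last by move=> /fwd[].
split; first by move=> /fwd[].
move=> /= /andP[b1 b2].
have pi0 := path_prob_ge0 h n.
have F0 : 0 <= F (h n) (h n.+1) by exact: cdf_ge0.
have F1 := cdf_succ_le1 (h n) (h n.+1).
have bn : path_inf h n <= u < path_inf h n + path_prob h n.
  apply/andP; split; first by rewrite (le_trans _ b1)// lerDl mulr_ge0.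
  by rewrite (lt_le_trans b2)// -addrA -mulrDr lerD2l ler_piMr.
have En := IH1.2 bn; have uE := IH2 En.
have {}pi0 : 0 < path_prob h n by lra.
(* With [u] written as an affine function of the residual at time [n], the bounds on [u] become
   bounds on that residual. *)
move: b1 b2; rewrite {1 2}uE lerD2l ler_pM2l// -addrA ltrD2l -mulrDr.
rewrite ltr_pM2l// => c1 c2 k; rewrite leq_eqVlt => /predU1P[->|/En//].
have [m1 m2] := nextP (traj u n).1 (traj_unit n u01).
rewrite /= -/(traj u n) En//; rewrite En// in m1 m2.
apply: (@cdf_unique _ _ _ (P_ge0 (h n)) (succ (h n)) (traj u n).2) => //.
  (* A state outside [succ (h n)] has probability 0, hence an empty piece. *)
  by have [//|/P_notin p0] := boolP (h n.+1 \in succ (h n));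
    have := le_lt_trans c1 c2; rewrite p0 addr0 ltxx.
by rewrite c1 c2.
Qed.

(** The sample space is the whole line. Points outside [0, 1[, null for [uniform01], are sent to 0
    so that the chain starts and moves correctly at every [w]. *)
Definition clip01 (w : R) : R := if 0 <= w < 1 then w else 0.

Lemma clip01_unit w : 0 <= clip01 w < 1.
Proof. by rewrite /clip01; case: ifP => //; rewrite lexx ltr01. Qed.

Definition canonical_chain (n : nat) (w : measurableTypeR R) : S :=
  (traj (clip01 w) n).1.

Local Notation Y := canonical_chain.

Lemma canonical_chain_succ n w : Y n.+1 w \in succ (Y n w).
Proof. by have [] := nextP (traj (clip01 w) n).1 (traj_unit n (clip01_unit w)). Qed.

Lemma measurable_clip01_itv a b :
  measurable ([set w | a <= clip01 w < b] : set (measurableTypeR R)).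
Proof.
have -> : [set w | a <= clip01 w < b] =
    (`[a, b[ `&` `[0, 1[) `|` (if a <= 0 < b then ~` `[(0 : R), 1[ else set0).
  apply/seteqP; split=> w /=; rewrite /clip01.
    case: ifPn => w01 wab; first by left; rewrite !in_itv.
    by right; rewrite wab /= in_itv; apply/negP.
  rewrite !in_itv => -[[wab ->]//|]; case: ifPn => [ab0 /= |//].
  by rewrite in_itv /= => /negP/negbTE ->.
apply: measurableU; first by apply: measurableI; exact: measurable_itv.
by case: ifP => // _; apply: measurableC; exact: measurable_itv.
Qed.

Definition path_event (h : nat -> S) (n : nat) : set (measurableTypeR R) :=
  [set w | forall k, (k <= n)%N -> Y k w = h k].

Lemma path_eventE h n : h 0%N = x0 ->
  path_event h n =
    [set w | path_inf h n <= clip01 w < path_inf h n + path_prob h n].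
Proof.
move=> h0; apply/seteqP; split=> w /= H.
  exact: (traj_path n h0 (clip01_unit w)).1.1.
exact: (traj_path n h0 (clip01_unit w)).1.2.
Qed.

Lemma path_event0 h n : h 0%N <> x0 -> path_event h n = set0.
Proof.
by move=> h0; apply/seteqP; split=> w //= /(_ 0%N isT) e; apply: h0; rewrite -e.
Qed.

Lemma measurable_path_event h n : measurable (path_event h n).
Proof.
have [h0|h0] := eqVneq (h 0%N) x0.
  by rewrite path_eventE//; exact: measurable_clip01_itv.
by rewrite path_event0//; apply/eqP.
Qed.

Lemma uniform01_path_event h n : h 0%N = x0 ->
  uniform01 (path_event h n) = (path_prob h n)%:E.
Proof.
move=> h0; rewrite path_eventE// /uniform01 /mrestr.
have [a0 a1] := path_inf_bounds h n; have pi0 := path_prob_ge0 h n.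
rewrite (_ : _ `&` _ = `[path_inf h n, path_inf h n + path_prob h n[%classic).
  rewrite lebesgue_measure_itv /= lte_fin ltrDl.
  have [_|p0] := ltP 0 (path_prob h n); first by rewrite -EFinB addrC addKr.
  by congr (_%:E); lra.
apply/seteqP; split=> w /=; rewrite !in_itv /= /clip01; first by case=> + w01; rewrite w01.
move=> /andP[w1 w2]; have w01 : 0 <= w < 1 by apply/andP; split; lra.
by rewrite w01 w1 w2.
Qed.

(** Finite paths are coded by the countable type [seq S], which makes the preimage a countable union
    of path events. *)
Lemma canonical_chain_measurable n y : measurable (Y n @^-1` [set y]).
Proof.
have -> : Y n @^-1` [set y] = \bigcup_(t : seq S)
    (if nth x0 t n == y then path_event (nth x0 t) n else set0).
  apply/seteqP; split=> w /=.
    move=> Yn; exists (mkseq (Y^~ w) n.+1) => //.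
    rewrite nth_mkseq// Yn eqxx => k kn; rewrite nth_mkseq//.
  by move=> [t _]; case: ifP => // /eqP <- /(_ n (leqnn n)).
apply: countable_bigcupT_measurable; first exact: countableP.
by move=> t; case: ifP => // _; exact: measurable_path_event.
Qed.

Lemma canonical_chain_markov :
  markov_chain P (@uniform01 R : probability _ R) Y.
Proof.
split; first exact: canonical_chain_measurable.
move=> n h; rewrite -/(path_event h n.+1) -/(path_event h n).
have [h0|/eqP h0] := eqVneq (h 0%N) x0.
  have PrE m : (@uniform01 R : probability _ R) (path_event h m) =
    (path_prob h m)%:E by exact: uniform01_path_event.
  by rewrite !PrE.
by rewrite !path_event0// measure0 mul0e.
Qed.

End ChainConstruction.

(** The mean drift is defined by almost sure limits along realizations, so one is needed to exploit
    it. Start and steps are controlled at every [w], which yields pointwise bounds for dominated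
    convergence. *)
Lemma markov_chain_exists (R : realType) (S : countType) (P : S -> S -> R)
    (succ : S -> seq S) (x0 : S) :
  (forall x y, 0 <= P x y) -> (forall x, uniq (succ x)) ->
  (forall x y, y \notin succ x -> P x y = 0) ->
  (forall x, \sum_(y <- succ x) P x y = 1) ->
  exists (Pr : probability (measurableTypeR R) R)
    (Y : nat -> measurableTypeR R -> S),
  [/\ markov_chain P Pr Y, forall w, Y 0%N w = x0 &
      forall n w, Y n.+1 w \in succ (Y n w)].
Proof.
move=> P0 U N S1; exists (@uniform01 R), (canonical_chain P succ x0).
split; first exact: canonical_chain_markov.
  by [].
by move=> n w; exact: canonical_chain_succ.
Qed.

(** * Expectations along a realization as iterates of the one-step operator *)

Section ChainExpectation.
Variables (R : realType) (S : countType) (P : S -> S -> R) (succ : S -> seq S).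
Hypothesis succ_uniq : forall x, uniq (succ x).
Variables (disp : measure_display) (Omega : measurableType disp).
Variables (Pr : probability Omega R) (Y : nat -> Omega -> S) (x0 : S).
Hypothesis Y_markov : markov_chain P Pr Y.
Hypothesis Y0 : forall w, Y 0%N w = x0.
Hypothesis Y_succ : forall n w, Y n.+1 w \in succ (Y n w).

Definition mean_op (g : S -> R) (x : S) : R := \sum_(y <- succ x) P x y * g y.

Lemma measurable_chain_fun (g : S -> R) n : measurable_fun setT (fun w => g (Y n w)).
Proof.
move=> _ B mB; rewrite setTI.
have -> : (fun w => g (Y n w)) @^-1` B =
    \bigcup_(y : S) (if g y \in B then Y n @^-1` [set y] else set0).
  apply/seteqP; split=> w /=; first by move=> gB; exists (Y n w) => //; rewrite mem_set.
  by move=> [y _]; case: ifP => // /set_mem gB ->.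
apply: countable_bigcupT_measurable; first exact: countableP.
by move=> y; case: ifP => // _; apply: Y_markov.1.
Qed.

Let cyl (h : nat -> S) n := [set w | forall k, (k <= n)%N -> Y k w = h k].

Let measurable_cyl h n : measurable (cyl h n).
Proof.
rewrite (_ : cyl h n = \bigcap_(k in [set k | (k <= n)%N]) Y k @^-1` [set h k]).
  by apply: bigcap_measurable => [|k _]; [exists 0%N|exact: Y_markov.1].
by apply/seteqP; split=> w /= H k; exact: H.
Qed.

Let extend (h : nat -> S) n z := fun k => if k == n.+1 then z else h k.

Let cyl_extend h n z : cyl (extend h n z) n = cyl h n.
Proof.
by apply/seteqP; split=> w /= H k kn; rewrite H// /extend ltn_eqF// ltnS.
Qed.

(** Induction on [m], for all [k] and [h] at once: the cylinder splits disjointly according to the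
    state at time k + 1, and the Markov property factors out the transition to that state. *)
Let integral_cyl (g : S -> R) m k h : (forall w, 0 <= g (Y (k + m)%N w)) ->
  (\int[Pr]_(w in cyl h k) (g (Y (k + m)%N w))%:E =
   Pr (cyl h k) * (iter m mean_op g (h k))%:E)%E.
Proof.
elim: m k h => [|m IH] k h g0.
  rewrite addn0 /= muleC -integral_cst//; apply: eq_integral => w /set_mem /= H.
  by rewrite H.
have cylE : cyl h k = \big[setU/set0]_(z <- succ (h k)) cyl (extend h k z) k.+1.
  rewrite -bigcup_seq; apply/seteqP; split=> w /=.
    move=> H; exists (Y k.+1 w); first by rewrite /= -(H k)//.
    move=> j; rewrite leq_eqVlt => /predU1P[->|jk]; first by rewrite /extend eqxx.
    by rewrite H// /extend ltn_eqF.
  by move=> [z _] H j jk; rewrite H ?(leq_trans jk)// /extend ltn_eqF// ltnS.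
rewrite [in LHS]cylE ge0_integral_bigsetU//=; last 3 first.
- move=> z1 z2 _ _ [w [/(_ k.+1 (leqnn _)) + /(_ k.+1 (leqnn _))]].
  by rewrite /extend eqxx => -> .
- apply/measurable_realfun.measurable_EFinP.
  by apply: measurable_funS (measurable_chain_fun g _).
- by move=> w _; rewrite lee_fin.
under eq_bigr => z _.
  rewrite -addSnnS IH; last by move=> w; rewrite addSnnS.
  rewrite Y_markov.2 -/(cyl (extend h k z) k) cyl_extend /extend eqxx ltn_eqF//.
  over.
have pfin : Pr (cyl h k) \is a fin_num by exact: fin_num_measure.
rewrite -(fineK pfin) -EFinM /mean_op mulr_sumr -sumEFin; apply: eq_bigr => z _.
by rewrite -!EFinM mulrA.
Qed.

Lemma chain_expectation (g : S -> R) n : (forall w, 0 <= g (Y n w)) ->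
  (\int[Pr]_w (g (Y n w))%:E = (iter n mean_op g x0)%:E)%E.
Proof.
move=> g0; have := @integral_cyl g n 0%N (fun=> x0) g0.
have -> : cyl (fun=> x0) 0 = setT.
  by apply/seteqP; split=> w //= _ k; rewrite leqn0 => /eqP ->.
by rewrite probability_setT mul1e add0n.
Qed.

End ChainExpectation.

(** * The transition operator of the expanded chains *)

Section WalkOperator.
Variables (R : realType) (d : nat) (L : mmrrw R d).
Implicit Types (A B : {set 'I_d}) (y : site d) (f g : site d -> R).

Local Notation valid := (valid (nphase L)).

Definition max_phase : nat := \max_(A : {set 'I_d}) nphase L A.

(** New phase and increment vector. One finite type serves all sites and all indices; moves to
    invalid sites get weight 0 in [kern]. *)
Definition move : finType := ({ffun 'I_d -> 'I_3} * 'I_max_phase)%type.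

(* [0, 1, 2 : 'I_3] encode the increments -1, 0, 1. *)
Definition step y (w : move) : site d :=
  ([ffun l => y.1 l + ((w.1 l : nat)%:Z - 1)], (w.2 : nat)).

(** Extended by 0 to invalid sites, so that the chains of all indices act on functions of the single
    type [site d] and can be compared. *)
Definition kern A y y' : R :=
  if valid A y' then transition (prob L) A y y' else 0.

Definition walk_op A f y : R := \sum_(w : move) kern A y (step y w) * f (step y w).

Local Notation T := walk_op.

Lemma validP A y :
  reflect ((forall l, l \notin A -> 0 <= y.1 l) /\ (y.2 < nphase L (face A y.1))%N)
          (valid A y).
Proof.
apply: (iffP andP) => -[H ?]; split=> //.
  by move=> l; apply/implyP; exact: (forallP H).
by apply/forallP => l; apply/implyP; exact: H.
Qed.

Lemma step_inj y : injective (step y).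
Proof.
move=> [w1 j1] [w2 j2] [/ffunP /= e1 e2]; congr (_, _); last exact: val_inj.
by apply/ffunP => l; apply/val_inj; have := e1 l; rewrite !ffunE => /addrI/addIr[].
Qed.

Lemma step_near y w l : `|(step y w).1 l - y.1 l| <= 1.
Proof.
by rewrite /= ffunE [_ + (_ - 1)]addrC addrK; case: (w.1 l) => -[|[|[|]]].
Qed.

Lemma near_step A y y' : valid A y' -> (forall l, `|y'.1 l - y.1 l| <= 1) ->
  exists w, step y w = y'.
Proof.
move=> /andP[_ j_lt] near.
have j_lt' : (y'.2 < max_phase)%N by apply: leq_trans j_lt _; exact: leq_bigmax.
have inc_lt l : (absz (y'.1 l - y.1 l + 1)%R < 3)%N by have := near l; lia.
exists ([ffun l => Ordinal (inc_lt l)], Ordinal j_lt').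
rewrite [RHS]surjective_pairing; congr (_, _).
by apply/ffunP => l; rewrite !ffunE /=; have := near l; lia.
Qed.

Lemma kern_ge0 A y y' : 0 <= kern A y y'.
Proof. by rewrite /kern /transition; do 2 case: ifP => // _; exact: prob_ge0. Qed.

Lemma kern_invalid A y y' : ~~ valid A y' -> kern A y y' = 0.
Proof. by rewrite /kern => /negbTE ->. Qed.

Lemma transition_stepE A y y' : valid A y' ->
  transition (prob L) A y y' = \sum_w (step y w == y')%:R * kern A y (step y w).
Proof.
move=> vy'; have [near|far] := boolP [forall l, `|y'.1 l - y.1 l| <= 1].
  have [w0 w0E] := near_step vy' (forallP near).
  rewrite (bigD1 w0)//= big1 => [|w ww0].
    by rewrite w0E eqxx mul1r addr0 /kern vy'.
  by rewrite -w0E (inj_eq (@step_inj y)) (negbTE ww0) mul0r.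
rewrite /transition (negbTE far) big1// => w _.
case: eqP => [e|_]; last by rewrite mul0r.
by case/negP: far; apply/forallP => l; rewrite -e; exact: step_near.
Qed.

Lemma walk_op_ext A f g y : (forall y', valid A y' -> f y' = g y') -> T A f y = T A g y.
Proof.
move=> fg; apply: eq_bigr => w _.
have [v|v] := boolP (valid A (step y w)); first by rewrite fg.
by rewrite kern_invalid// !mul0r.
Qed.

Lemma walk_op_le A f g y : (forall y', valid A y' -> f y' <= g y') -> T A f y <= T A g y.
Proof.
move=> fg; apply: ler_sum => w _.
have [v|v] := boolP (valid A (step y w)); first by rewrite ler_wpM2l ?kern_ge0// fg.
by rewrite kern_invalid// !mul0r.
Qed.

Lemma iter_walk_op_ext A n f g y : valid A y ->
  (forall y', valid A y' -> f y' = g y') -> iter n (T A) f y = iter n (T A) g y.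
Proof.
by move=> + fg; elim: n y => [|n IH] y vy /=; [exact: fg|exact: walk_op_ext].
Qed.

Lemma iter_walk_op_le A n f g y : valid A y ->
  (forall y', valid A y' -> f y' <= g y') -> iter n (T A) f y <= iter n (T A) g y.
Proof.
by move=> + fg; elim: n y => [|n IH] y vy /=; [exact: fg|exact: walk_op_le].
Qed.

Lemma iter_walk_op_sum A n (I : Type) (r : seq I) (F : I -> site d -> R) y :
  iter n (T A) (fun y' => \sum_(i <- r) F i y') y = \sum_(i <- r) iter n (T A) (F i) y.
Proof.
elim: n y => [//|n IH] y /=; rewrite exchange_big; apply: eq_bigr => w _ /=.
by rewrite IH mulr_sumr.
Qed.

Lemma iter_walk_opD A n f g y :
  iter n (T A) (fun y' => f y' + g y') y = iter n (T A) f y + iter n (T A) g y.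
Proof.
elim: n y => [//|n IH] y /=; rewrite -big_split; apply: eq_bigr => w _ /=.
by rewrite IH mulrDr.
Qed.

Lemma iter_walk_opZ A n (c : R) f y :
  iter n (T A) (fun y' => c * f y') y = c * iter n (T A) f y.
Proof.
elim: n y => [//|n IH] y /=; rewrite mulr_sumr; apply: eq_bigr => w _ /=.
by rewrite IH mulrCA.
Qed.

Lemma iter_walk_opB A n f g y :
  iter n (T A) (fun y' => f y' - g y') y = iter n (T A) f y - iter n (T A) g y.
Proof.
by under eq_fun do rewrite -mulN1r; rewrite iter_walk_opD iter_walk_opZ mulN1r.
Qed.

Lemma iter_walk_op_ge0 A n f y :
  (forall y', 0 <= f y') -> 0 <= iter n (T A) f y.
Proof.
move=> f0; elim: n y => [//|n IH] y /=.
by apply: sumr_ge0 => w _; rewrite mulr_ge0 ?kern_ge0.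
Qed.

Lemma face_sub A B (x : {ffun 'I_d -> int}) : A \subset B ->
  (forall l, l \in B -> l \notin A -> 0 < x l) -> face B x = face A x.
Proof.
move=> /fintype.subsetP AB xB; apply/setP => l; rewrite !inE.
have [/AB ->//|lA] := boolP (l \in A).
by have [lB|lB] := boolP (l \in B); first rewrite xB.
Qed.

Lemma valid_sub A B y : A \subset B ->
  (forall l, l \in B -> l \notin A -> 0 < y.1 l) -> valid B y = valid A y.
Proof.
move=> AB yB; rewrite /Defs.valid (face_sub AB yB); congr (_ && _).
apply/forallP/forallP => H l; apply/implyP => lA.
  have [lB|lB] := boolP (l \in B); first by rewrite ltW ?yB.
  by have := H l; rewrite lB.
by have := H l; rewrite (contraNN _ lA)//; move/fintype.subsetP: AB; apply.
Qed.

Lemma kern_sub A B y y' : A \subset B ->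
  (forall l, l \in B -> l \notin A -> 0 < y.1 l) ->
  (forall l, l \in B -> l \notin A -> 0 < y'.1 l) -> kern B y y' = kern A y y'.
Proof.
move=> AB yB y'B; rewrite /kern (valid_sub AB)//; case: ifP => // _.
by rewrite /transition (face_sub AB yB) (face_sub AB y'B).
Qed.

(* The two chains cannot be told apart before a coordinate in B \ A reaches 0. *)
Lemma iter_walk_op_sub A B n f y : A \subset B ->
  (forall l, l \in B -> l \notin A -> n%:Z < y.1 l) ->
  iter n (T B) f y = iter n (T A) f y.
Proof.
move=> AB; elim: n y => [//|n IH] y yB /=; apply: eq_bigr => w _.
have ny l : l \in B -> l \notin A -> n%:Z < (step y w).1 l.
  by move=> lB lA; have := step_near y w l; have := yB l lB lA; lia.
rewrite IH// (kern_sub AB)// => l lB lA; first by have := yB l lB lA; lia.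
by have := ny l lB lA; lia.
Qed.

Definition shift (v : {ffun 'I_d -> int}) y : site d := ([ffun l => y.1 l + v l], y.2).

Definition supported A (v : {ffun 'I_d -> int}) := forall l, l \notin A -> v l = 0.

Lemma face_shift A v y : supported A v -> face A (shift v y).1 = face A y.1.
Proof.
move=> vA; apply/setP => l; rewrite !inE ffunE; case: (boolP (l \in A)) => //= lA.
by rewrite vA// addr0.
Qed.

Lemma valid_shift A v y : supported A v -> valid A (shift v y) = valid A y.
Proof.
move=> vA; rewrite /Defs.valid face_shift//; congr (_ && _); apply: eq_forallb => l.
by rewrite ffunE; case: (boolP (l \in A)) => //= lA; rewrite vA// addr0.
Qed.

(** The coordinates in [A] are unrestricted and do not influence [face A], so only their increments
    matter. *)
Lemma kern_shift A v y y' : supported A v ->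
  kern A (shift v y) (shift v y') = kern A y y'.
Proof.
move=> vA; rewrite /kern valid_shift//; case: ifP => // _.
rewrite /transition !face_shift//.
have dE l : (shift v y').1 l - (shift v y).1 l = y'.1 l - y.1 l.
  by rewrite !ffunE opprD addrACA subrr addr0.
under eq_forallb do rewrite dE; case: ifP => // _.
by congr (prob L _ _ _ _ _); apply/ffunP => l; rewrite ffunE dE ffunE.
Qed.

Lemma step_shift v y w : step (shift v y) w = shift v (step y w).
Proof. by congr (_, _); apply/ffunP => l; rewrite !ffunE addrAC. Qed.

Lemma iter_walk_op_shift A n v f y : supported A v ->
  iter n (T A) f (shift v y) = iter n (T A) (f \o shift v) y.
Proof.
move=> vA; elim: n y => [//|n IH] y /=; apply: eq_bigr => w _.
by rewrite step_shift kern_shift// IH.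
Qed.

Lemma forget_shift A v y : supported A v -> forget A (shift v y) = forget A y.
Proof.
move=> vA; congr (_, _); apply/ffunP => l; rewrite !ffunE.
by case: ifPn => // lA; rewrite vA// addr0.
Qed.

Lemma shift_forget A y : exists2 v, supported A v & y = shift v (forget A y).
Proof.
exists [ffun l => if l \in A then y.1 l else 0].
  by move=> l /negbTE lA; rewrite ffunE lA.
case: y => x j; congr (_, _); apply/ffunP => l; rewrite !ffunE /=.
by case: ifP; rewrite ?add0r ?addr0.
Qed.

Lemma valid_forget A y : valid A (forget A y) = valid A y.
Proof. by have [v vA yE] := shift_forget A y; rewrite [in RHS]yE valid_shift. Qed.

End WalkOperator.

(** * The chains of the statement in terms of the operator *)

(** After exchanging the sums, each [i] leaves the single candidate [s i]. The map [s] need not be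
    injective: in the induced chain several moves can have the same image. *)
Lemma esum_sub_image (R : realType) (T : countType) (Q c : pred T) (I : finType)
    (s : I -> T) (a : I -> R) (F : T -> R) :
  (forall i, 0 <= a i) -> (forall t, 0 <= F t) ->
  (\esum_(z in [set z : {t | Q t} | c (val z)])
     (\sum_i (s i == val z)%:R * a i * F (val z))%:E =
   (\sum_i (Q (s i) && c (s i))%:R * (a i * F (s i)))%:E)%E.
Proof.
move=> a0 F0; under eq_esum do rewrite -sumEFin.
have ge0 (z : {t | Q t}) i : (0 <= ((s i == val z)%:R * a i * F (val z))%:E)%E.
  by rewrite lee_fin mulr_ge0// mulr_ge0.
rewrite esum_sum// -sumEFin; apply: eq_bigr => i _.
have [/andP[Qi ci]|off] := boolP (Q (s i) && c (s i)); last first.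
  rewrite mul0r esum1// => z /= cz; case: eqP => [e|_]; last by rewrite !mul0r.
  by move: off; rewrite e cz (valP z).
pose z0 : {t | Q t} := exist _ (s i) Qi.
rewrite (esumID [set z0])//.
rewrite (_ : _ `&` [set z0] = [set z0]); last first.
  by apply/seteqP; split=> z //=; [case|move=> ->].
rewrite esum_set1//= eqxx mul1r; last by rewrite lee_fin mulr_ge0.
rewrite esum1 ?adde0 ?mul1r// => z /= [_ zz0].
case: eqP => [e|_]; last by rewrite !mul0r.
by case: zz0; apply/val_inj.
Qed.

Lemma fsbig_sub_image (R : realType) (T : countType) (Q c : pred T) (I : finType)
    (s : I -> T) (a : I -> R) :
  (forall i, 0 <= a i) ->
  \sum_(z \in [set z : {t | Q t} | c (val z)]) (\sum_i (s i == val z)%:R * a i) =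
  \sum_i (Q (s i) && c (s i))%:R * a i.
Proof.
move=> a0; set C := [set z | _].
(* The images lying in the subtype; the summand vanishes elsewhere, so the sum has finite
   support. *)
pose r : seq {t | Q t} := undup (pmap insub [seq s i | i <- enum I]).
have r0 z : z \notin r -> \sum_i (s i == val z)%:R * a i = 0.
  move=> zr; rewrite big1// => i _; case: eqP => [e|_]; last by rewrite mul0r.
  case/negP: zr; rewrite mem_undup mem_pmap; apply/mapP; exists (s i).
    by apply: map_f; rewrite mem_enum.
  by rewrite e valK.
have sum_ge0 (z : {t | Q t}) : 0 <= \sum_i (s i == val z)%:R * a i.
  by apply: sumr_ge0 => i _; rewrite mulr_ge0.
rewrite -(@fsbig_widen _ _ _ _ (C `&` [set` r])); last 2 first.
- by move=> z [].
- by move=> z /= [Cz nz]; apply: r0; apply/negP => zr; apply: nz.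
have fin : finite_set (C `&` [set` r]) by apply: finite_setIr; exact: finite_seq.
apply: EFin_inj; rewrite -fsumEFin// -esum_fset//; last by move=> z _; rewrite lee_fin.
have := @esum_sub_image R T Q c I s a (fun=> 1) a0 (fun=> ler01).
under eq_bigr do rewrite mulr1; move=> <-; rewrite -/C.
rewrite [RHS](esumID [set` r]); last first.
  by move=> z _; under eq_bigr do rewrite mulr1; rewrite lee_fin.
rewrite [X in (_ + X)%E]esum1 ?adde0; last first.
  by move=> z /= [_ zr]; under eq_bigr do rewrite mulr1; rewrite r0//; exact/negP.
by apply: eq_esum => z _; under [in RHS]eq_bigr do rewrite mulr1.
Qed.

Section WalkLinks.
Variables (R : realType) (d : nat) (L : mmrrw R d).
Implicit Types (A B : {set 'I_d}) (y : site d) (f g : site d -> R).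

Local Notation valid := (valid (nphase L)).
Local Notation T := (walk_op L).
Local Notation step := (@step R d L).
Local Notation kern := (kern L).

Lemma esum_transition A (x : state (nphase L) A) (c : pred (site d)) f :
  (forall y, 0 <= f y) ->
  (\esum_(z in [set z : state (nphase L) A | c (val z)])
     ((transition (prob L) A (val x) (val z))%:E * (f (val z))%:E) =
   (T A (fun y => (c y)%:R * f y) (val x))%:E)%E.
Proof.
move=> f0; under eq_esum => z _.
  rewrite transition_stepE ?(valP z)// -EFinM mulr_suml; over.
rewrite (@esum_sub_image _ _ (valid A) c _ (step (val x)) _ f)// => [|w]; last first.
  exact: kern_ge0.
congr (_%:E); apply: eq_bigr => w _.
have [v|v] := boolP (valid A (step (val x) w)); first by rewrite mulrCA.
by rewrite kern_invalid// !(mul0r, mulr0).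
Qed.

(** Total mass 1 is given for the walk itself only. Translating the coordinates in [A] to 2, from
    where one step cannot reach 0, identifies one step of the expanded chain with one step of the
    walk. *)
Lemma walk_op1 A y : valid A y -> T A (fun=> 1) y = 1.
Proof.
move=> vy; pose v : {ffun 'I_d -> int} := [ffun l => if l \in A then 2 - y.1 l else 0].
have vA : supported A v by move=> l /negbTE lA; rewrite ffunE lA.
have y2A l : l \in A -> (shift v y).1 l = 2.
  by move=> lA; rewrite /= !ffunE lA addrC subrK.
have v0 : valid finset.set0 (shift v y).
  rewrite -(@valid_sub _ _ _ _ A) ?finset.sub0set//; first by rewrite valid_shift.
  by move=> l lA _; rewrite y2A.
have := @iter_walk_op_shift _ _ L A 1 v (fun=> 1) y vA => /= <-.
have /= -> := @iter_walk_op_sub _ _ L finset.set0 A 1 (fun=> 1) (shift v y).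
- pose x : state (nphase L) finset.set0 := exist _ (shift v y) v0.
  apply: EFin_inj; rewrite -(prob_sum1 x).
  have := @esum_transition finset.set0 x predT (fun=> 1) (fun=> ler01).
  rewrite (_ : [set z | _] = setT); last by apply/seteqP.
  under eq_esum => z _ do rewrite mule1.
  by move=> ->; congr (_%:E); apply: eq_bigr => w _; rewrite mul1r.
- exact: finset.sub0set.
- by move=> l lA _; rewrite y2A.
Qed.

End WalkLinks.

(** * Laws after n steps, avoidance probabilities and occupation times *)

Section Survival.
Variables (R : realType) (d : nat) (L : mmrrw R d).
Implicit Types (A B : {set 'I_d}) (y : site d) (f g : site d -> R).
Implicit Types c : pred (site d).

Local Notation valid := (valid (nphase L)).
Local Notation T := (walk_op L).
Local Notation step := (@step R d L).
Local Notation kern := (kern L).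

Lemma iter_walk_op_cst A n (a : R) y : valid A y -> iter n (T A) (fun=> a) y = a.
Proof.
move=> vy; rewrite -[RHS]mulr1 -[a in LHS]mulr1 (iter_walk_opZ _ _ _ _ (fun=> 1)).
congr (_ * _); elim: n y vy => [//|n IH] y vy /=.
by rewrite (walk_op_ext (g := fun=> 1))// walk_op1.
Qed.

Lemma nstepE n (x y : walk_state L) :
  nstep (@walk_chain _ _ L) n x y =
  (iter n (T finset.set0) (fun y' => (y' == val y)%:R) (val x))%:E.
Proof.
elim: n x => [//|n IH] x /=; rewrite (_ : [set: _] =
  [set z : state (nphase L) finset.set0 | predT (val z)]); last by apply/seteqP.
under eq_esum do rewrite IH.
rewrite (esum_transition _ predT (f := iter n (T finset.set0) _)).
  by congr (_%:E); apply: eq_bigr => w _; rewrite mul1r.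
by move=> t; apply: iter_walk_op_ge0.
Qed.

(** Skip-freeness: only finitely many sites can be reached in [n] steps. *)
Lemma iter_walk_op_finite A n y : valid A y -> exists r : seq (site d),
  [/\ uniq r, all (valid A) r &
      forall f g, {in r, f =1 g} -> iter n (T A) f y = iter n (T A) g y].
Proof.
elim: n y => [|n IH] y vy.
  exists [:: y]; split=> //=; first by rewrite vy.
  by move=> f g /(_ y); rewrite mem_head; apply.
have /choice[r rP] : forall w, exists r : seq (site d), valid A (step y w) ->
    [/\ uniq r, all (valid A) r &
      forall f g, {in r, f =1 g} ->
        iter n (T A) f (step y w) = iter n (T A) g (step y w)].
  move=> w; have [/IH[r rP]|v] := boolP (valid A (step y w)); first by exists r.
  by exists nil.
exists (undup (flatten [seq r w | w <- enum (move L) & valid A (step y w)])).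
split; first exact: undup_uniq.
  apply/allP => z; rewrite mem_undup => /flatten_mapP[w].
  by rewrite mem_filter => /andP[/rP[_ /allP + _] _]; exact.
move=> f g fg /=; apply: eq_bigr => w _.
have [v|v] := boolP (valid A (step y w)); last by rewrite kern_invalid// !mul0r.
have [_ _ /(_ f g) ->//] := rP w v.
move=> z zr; apply: fg; rewrite mem_undup; apply/flatten_mapP; exists w => //.
by rewrite mem_filter v mem_enum.
Qed.

(** The displacement is expanded over the finite support [r] into point indicators, and linearity of
    the operator reassembles it. *)
Lemma mean_incrementE (K u : {set 'I_d} -> nat) (y : walk_state L) l :
  mean_increment K u y l =
  iter (sojourn K u y) (T finset.set0)
    (fun y' => (y'.1 l - (val y).1 l)%:~R) (val y).
Proof.
rewrite /mean_increment /embedded; set n := sojourn K u y.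
pose g (y' : site d) : R := (y'.1 l - (val y).1 l)%:~R.
have [r [ur vr rP]] := iter_walk_op_finite n (valP y).
have zero z : z \notin r -> iter n (T finset.set0) (fun y' => (y' == z)%:R) (val y) = 0.
  move=> zr; rewrite (rP _ (fun=> 0)); last first.
    by move=> t tr /=; case: eqP => // e; rewrite -e tr in zr.
  by rewrite iter_walk_op_cst// (valP y).
have r'P z : (z \in pmap insub r) = (val z \in r).
  by rewrite mem_pmap_sub.
under eq_fsbigr do rewrite nstepE /=.
rewrite -(@fsbig_widen _ _ _ _ [set` pmap insub r])//=; last first.
  by move=> z [_ /negP zr]; rewrite /= zero ?mul0r// -r'P.
rewrite -fsbig_seq ?pmap_sub_uniq// big_pmap.
transitivity (\sum_(t <- r) iter n (T finset.set0) (fun y' => g t * (y' == t)%:R) (val y)).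
  apply: eq_big_seq => t tr; have vt := allP vr t tr.
  by rewrite iter_walk_opZ mulrC insubT.
rewrite -(iter_walk_op_sum _ _ n r (fun t y' => g t * (y' == t)%:R)).
apply: rP => t tr /=; rewrite (bigD1_seq t)//= eqxx mulr1 big1 ?addr0// => z.
by rewrite eq_sym => /negbTE ->; rewrite mulr0.
Qed.

(* [surv A c n y] is the probability that the chain started at [y] avoids [c] at
   times 1, ..., n. *)
Fixpoint surv A c n : site d -> R :=
  if n is n'.+1 then T A (fun y => (~~ c y)%:R * surv A c n' y) else fun=> 1.

Lemma surv_ge0 A c n y : 0 <= surv A c n y.
Proof.
elim: n y => [//|n IH] y /=; apply: sumr_ge0 => w _.
by rewrite mulr_ge0 ?kern_ge0// mulr_ge0.
Qed.

Lemma surv_nonincreasing A c n y : valid A y -> surv A c n.+1 y <= surv A c n y.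
Proof.
elim: n y => [|n IH] y vy.
  rewrite /= -[leRHS](walk_op1 vy); apply: walk_op_le => y' _.
  by case: (c y'); rewrite ?mul0r ?mul1r.
by apply: walk_op_le => y' vy'; rewrite ler_wpM2l// IH.
Qed.

Lemma surv_shift A c n v y : supported A v -> (forall y, c (shift v y) = c y) ->
  surv A c n (shift v y) = surv A c n y.
Proof.
move=> vA cv; elim: n y => [//|n IH] y /=.
have /= -> := iter_walk_op_shift L 1 (fun y => (~~ c y)%:R * surv A c n y) y vA.
apply: eq_bigr => w _.
by rewrite /= IH cv.
Qed.

(* Decomposition at the last visit to [c] before time [N]. *)
Lemma last_visit A c N y : valid A y ->
  \sum_(k < N.+1) iter k (T A) (fun y' => (c y')%:R * surv A c (N - k) y') y =
  1 - (~~ c y)%:R * surv A c N y.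
Proof.
elim: N y => [|N IH] y vy.
  rewrite big_ord_recl big_ord0 /= addr0 !mulr1.
  by case: (c y); rewrite /= ?subr0 ?subrr.
rewrite big_ord_recl.
have E : \sum_(k < N.+1) T A (iter k (T A) (fun y' => (c y')%:R * surv A c (N - k) y')) y
    = 1 - surv A c N.+1 y.
  have /= <- := iter_walk_op_sum L A 1 (index_enum 'I_N.+1)
    (fun k : 'I_N.+1 => iter k (T A) (fun y' => (c y')%:R * surv A c (N - k) y')) y.
  rewrite (walk_op_ext (g := fun y' => 1 - (~~ c y')%:R * surv A c N y')) => [|y' vy'].
    have /= -> := iter_walk_opB L A 1 (fun=> 1) (fun y' => (~~ c y')%:R * surv A c N y') y.
    by rewrite walk_op1.
  exact: IH.
rewrite [X in _ + X]E /= -/(surv A c N.+1 y); case: (c y) => /=; ring.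
Qed.

(** A visit to [c] is the last one with conditional probability at least [e]; the events of a last
    visit at time [k] are disjoint, so their probabilities add up to at most 1. *)
Lemma occupation_bound A c (e : R) N y : valid A y -> 0 < e ->
  (forall n y', valid A y' -> c y' -> e <= surv A c n y') ->
  \sum_(k < N) iter k (T A) (fun y' => (c y')%:R) y <= e^-1.
Proof.
move=> vy e0 ce; rewrite -[leRHS]mul1r ler_pdivlMr//.
apply: (@le_trans _ _ (1 - (~~ c y)%:R * surv A c N y)); last first.
  by rewrite lerBlDr lerDl mulr_ge0// surv_ge0.
rewrite -last_visit// big_ord_recr /= mulr_suml.
rewrite -[leLHS]addr0 lerD//.
  apply: ler_sum => k _; rewrite mulrC -iter_walk_opZ; apply: iter_walk_op_le => // y' vy'.
  by case: (boolP (c y')) => cy'; rewrite ?mulr0 ?mul0r// mulr1 mul1r ce.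
by apply: iter_walk_op_ge0 => y'; rewrite mulr_ge0// surv_ge0.
Qed.

Lemma induced_chainE A (v z : induced_state (nphase L) A) :
  induced_chain v z =
  \sum_w (forget A (step (val v) w) == val z)%:R * kern A (val v) (step (val v) w).
Proof.
rewrite /induced_chain.
under eq_fsbigr => y' _ do rewrite (transition_stepE _ (valP y')).
rewrite (_ : [set _ | _] =
  [set y' : state (nphase L) A | (fun y => forget A y == val z) (val y')]).
  rewrite (fsbig_sub_image (valid A) (fun y => forget A y == val z)
    (step (val v)) (fun w => kern_ge0 L A (val v) (step (val v) w))).
  apply: eq_bigr => w _; have [//|u] := boolP (valid A (step (val v) w)).
  by rewrite kern_invalid// !mulr0.
by apply/seteqP; split=> y' /= /eqP.
Qed.

(** Avoiding [v] in the induced chain means avoiding the fibre of [forget A] over [v] in the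
    expanded chain; by translation invariance the avoidance probability depends on the projection
    only. *)
Lemma survivalE A (v : induced_state (nphase L) A) n (x : induced_state (nphase L) A) :
  survival (@induced_chain R d L A) [set v] n x =
  (surv A (fun y => forget A y == val v) n (val x))%:E.
Proof.
pose c := fun y => forget A y == val v.
elim: n x => [//|n IH] x /=.
pose Q y := valid A y && [forall l in A, y.1 l == 0].
rewrite (_ : ~` [set v] = [set z : {y | Q y} | val z != val v]); last first.
  by apply/seteqP; split=> z /= zv; [apply/eqP => /val_inj|move=> e; rewrite e eqxx in zv].
under eq_esum => z _.
  rewrite induced_chainE IH -EFinM mulr_suml; over.
rewrite (@esum_sub_image _ _ Q (fun y => y != val v) _
  (fun w => forget A (step (val x) w)) (fun w => kern A (val x) (step (val x) w))
  (surv A c n)); [|by move=> w; exact: kern_ge0|by move=> y; exact: surv_ge0].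
congr (_%:E); apply: eq_bigr => w _.
have [u|u] := boolP (valid A (step (val x) w)); last first.
  by rewrite kern_invalid// !(mul0r, mulr0).
have -> : Q (forget A (step (val x) w)).
  rewrite /Q valid_forget u; apply/forallP => l; apply/implyP => lA.
  by rewrite ffunE lA.
rewrite /= mulrCA; congr (_ * (_ * _)).
have [s sA sE] := shift_forget A (step (val x) w).
by rewrite [in RHS]sE surv_shift// => y; rewrite /c forget_shift.
Qed.

(** Avoidance probabilities decrease with [n], so if they do not tend to 0 they stay above some
    positive [e]. Translation carries the bound to every site over [v]. *)
Lemma transient_surv A (v : induced_state (nphase L) A) :
  transient (@induced_chain R d L A) v ->
  exists2 e : R, 0 < e &
    forall n y, valid A y -> forget A y == val v ->
      e <= surv A (fun y => forget A y == val v) n y.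
Proof.
move=> tv; apply: contrapT => no; apply: tv; rewrite /recurrent /passage_finite.
pose c := fun y => forget A y == val v.
under eq_fun do rewrite survivalE -/c.
have vA : valid A (val v) by have /andP[] := valP v.
apply/cvg_EFin; first by near=> n.
apply/cvgr0Pnorm_lt => e e0; apply: contrapT => far; apply: no; exists e => // n y vy cy.
have -> : surv A (fun y => forget A y == val v) n y = surv A c n (val v).
  have [s sA sE] := shift_forget A y.
  by rewrite sE surv_shift ?(eqP cy)// => z; rewrite forget_shift.
rewrite leNgt; apply/negP => lt_e; apply: far; exists n => // m /= nm.
rewrite ger0_norm ?surv_ge0//; apply: le_lt_trans lt_e.
rewrite -(subnK nm) addnC; elim: (m - n)%N => [|k IH]; first by rewrite addn0.
by rewrite addnS; apply: le_trans IH; exact: surv_nonincreasing.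
Unshelve. all: by end_near.
Qed.

End Survival.

(** * Mean displacement *)

Section DriftLimit.
Variables (R : realType) (d : nat) (L : mmrrw R d) (A : {set 'I_d}).

Local Notation valid := (valid (nphase L)).
Local Notation T := (walk_op L).
Local Notation step := (@step R d L).
Local Notation S := (state (nphase L) A).
Local Notation P := (@expanded_chain R d L A).

Definition mean_disp n (y : site d) (l : 'I_d) : R :=
  iter n (T A) (fun y' => (y'.1 l - y.1 l)%:~R) y.

Definition site_succ (x : S) : seq S :=
  pmap insub [seq step (val x) w | w <- enum (move L)].

Lemma site_succ_uniq x : uniq (site_succ x).
Proof. by apply: pmap_sub_uniq; rewrite map_inj_uniq ?enum_uniq//; exact: step_inj. Qed.

Lemma mem_site_succ x z : z \in site_succ x -> exists w, step (val x) w = val z.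
Proof. by rewrite mem_pmap_sub => /mapP[w _ ->]; exists w. Qed.

Lemma expanded_chain_notin x z : z \notin site_succ x -> P x z = 0.
Proof.
move=> zx; rewrite /expanded_chain (transition_stepE _ (valP z)) big1// => w _.
case: eqP => [e|_]; last by rewrite mul0r.
by case/negP: zx; rewrite mem_pmap_sub; apply/mapP; exists w; rewrite ?mem_enum.
Qed.

Lemma mean_opE (g : site d -> R) x :
  mean_op P site_succ (g \o val) x = T A g (val x).
Proof.
rewrite /mean_op big_pmap big_map big_enum; apply: eq_bigr => w _.
have [v|v] := boolP (valid A (step (val x) w)); last by rewrite kern_invalid// mul0r insubN.
by rewrite insubT/= /kern v.
Qed.

Lemma iter_mean_opE n (g : site d -> R) x :
  iter n (mean_op P site_succ) (g \o val) x = iter n (T A) g (val x).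
Proof.
elim: n x => [//|n IH] x /=; rewrite -mean_opE.
by congr (mean_op _ _ _ _); apply/funext => z; exact: IH.
Qed.

Lemma expanded_chain_sum1 x : \sum_(z <- site_succ x) P x z = 1.
Proof.
rewrite -(walk_op1 (valP x)) -mean_opE; apply: eq_bigr => z _.
by rewrite /= mulr1.
Qed.

Lemma expanded_chain_ge0 x z : 0 <= P x z.
Proof. by rewrite /expanded_chain /transition; case: ifP => // _; exact: prob_ge0. Qed.

(** Dominated convergence along one realization started at [y]; skip-freeness bounds the
    displacement per unit time by 1. *)
Lemma mean_disp_cvg (a : 'I_d -> R) y l : is_mean_drift L A a -> valid A y ->
  mean_disp n y l / n%:R @[n --> \oo] --> a l.
Proof.
move=> drift vy; pose x0 : S := exist _ y vy.
have [Pr [Y [YM Y0 Ysucc]]] := markov_chain_exists x0 expanded_chain_ge0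
  site_succ_uniq expanded_chain_notin expanded_chain_sum1.
have near n w : `|(val (Y n w)).1 l - y.1 l| <= n%:Z.
  elim: n => [|n IH]; first by rewrite Y0 subrr.
  have [m mE] := mem_site_succ (Ysucc n w).
  have := step_near (val (Y n w)) m l; rewrite mE; move: IH.
  move: ((val (Y n w)).1 l) ((val (Y n.+1 w)).1 l) (y.1 l) => i j k; lia.
(* Adding 1 makes the integrand nonnegative, as [chain_expectation] requires; the index [n.+1] keeps
   the denominator positive. *)
pose g n (z : site d) : R := (z.1 l - y.1 l)%:~R / n.+1%:R + 1.
have gnear n w : `|(val (Y n.+1 w)).1 l - y.1 l|%:~R <= n.+1%:R :> R.
  by rewrite -[n.+1%:R]/((n.+1)%:Z%:~R) ler_int near.
have g_bound n w : -1 <= (((val (Y n.+1 w)).1 l - y.1 l)%:~R / n.+1%:R : R) <= 1.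
  rewrite -ler_norml normrM normfV [`|n.+1%:R|]ger0_norm ?ler0n//.
  by rewrite ler_pdivrMr ?ltr0n// mul1r -intr_norm.
have g_ge0 n w : 0 <= g n (val (Y n.+1 w)).
  by have /andP[h _] := g_bound n w; rewrite /g -lerBlDr sub0r.
have intg n : (\int[Pr]_w (g n (val (Y n.+1 w)))%:E =
    (mean_disp n.+1 y l / n.+1%:R + 1)%:E)%E.
  rewrite (chain_expectation site_succ_uniq YM Y0 Ysucc (g := g n \o val)); last exact: g_ge0.
  rewrite iter_mean_opE iter_walk_opD iter_walk_op_cst//; congr (_ + _)%:E.
  rewrite mulrC -iter_walk_opZ; congr (iter _ _ _ _); apply/funext => z.
  by rewrite mulrC.
have [|||||_ _] := @dominated_convergence _ _ R Pr setT measurableT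
  (fun n w => (g n (val (Y n.+1 w)))%:E) (cst (a l + 1)%:E) (cst (2 : R)%:E).
- move=> m; apply/measurable_realfun.measurable_EFinP.
  exact: (measurable_chain_fun YM (g m \o val)).
- exact: measurable_cst.
- have := drift _ _ Pr Y YM; apply: filterS => w /(_ l) cw _.
  apply: cvg_EFin; first by near=> n.
  apply: cvgD; last exact: cvg_cst.
  rewrite -(cvg_shiftS (fun n => _)) in cw.
  apply: cvg_trans cw; apply: near_eq_cvg; near=> n.
  by rewrite /= Y0.
- exact: finite_measure_integrable_cst.
- apply: aeW => w n _ /=; rewrite lee_fin (le_trans (ler_normD _ _))//.
  by rewrite normr1 -lerBrDr addrK ler_norml g_bound.
under eq_fun do rewrite intg.
have intc : (\int[Pr]_w cst (a l + 1)%:E w)%E = (a l + 1)%:E.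
  by rewrite integral_cst// -[RHS]mule1; congr (_ * _)%E; exact: probability_setT.
rewrite intc => /fine_cvgP[_] /= cvg1.
have cvgS : mean_disp n.+1 y l / n.+1%:R @[n --> \oo] --> a l.
  rewrite -[a l](addrK 1).
  rewrite (_ : (fun n => _) = fun n => mean_disp n.+1 y l / n.+1%:R + 1 - 1).
    exact: cvgB cvg1 (cvg_cst (1 : R)).
  by apply/funext => n; rewrite addrK.
by rewrite (cvg_shiftS (fun n => mean_disp n y l / n%:R)) in cvgS.
Unshelve. all: by end_near.
Qed.

End DriftLimit.

Section MeanDisplacement.
Variables (R : realType) (d : nat) (L : mmrrw R d) (A : {set 'I_d}).
Implicit Types (y : site d) (f g : site d -> R).

Local Notation valid := (valid (nphase L)).
Local Notation T := (walk_op L).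
Local Notation mean_disp := (mean_disp L A).

Lemma norm_iter_walk_op n f g y : valid A y ->
  (forall y', valid A y' -> `|f y'| <= g y') ->
  `|iter n (T A) f y| <= iter n (T A) g y.
Proof.
move=> vy fg; rewrite ler_norml; apply/andP; split.
  rewrite -mulN1r -iter_walk_opZ; apply: iter_walk_op_le => // y' vy'.
  by rewrite mulN1r; have := fg y' vy'; rewrite ler_norml => /andP[].
apply: iter_walk_op_le => // y' vy'.
by have := fg y' vy'; rewrite ler_norml => /andP[].
Qed.

Lemma mean_disp_posE n y l : valid A y ->
  mean_disp n y l = iter n (T A) (fun y' => (y'.1 l)%:~R) y - (y.1 l)%:~R.
Proof.
move=> vy; rewrite -[X in _ - X](iter_walk_op_cst n _ vy) -iter_walk_opB.
by congr (iter _ _ _ _); apply/funext => y'; rewrite intrB.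
Qed.

Lemma mean_dispD n k y l : valid A y ->
  mean_disp (n + k) y l = mean_disp n y l + iter n (T A) (fun y' => mean_disp k y' l) y.
Proof.
move=> vy; rewrite (iter_walk_op_ext n vy (fun y' => @mean_disp_posE k y' l)).
by rewrite iter_walk_opB !mean_disp_posE// iterD; ring.
Qed.

Lemma mean_disp_le n y l : valid A y -> `|mean_disp n y l| <= n%:R.
Proof.
elim: n y => [|n IH] y vy; first by rewrite [X in `|X|](_ : _ = 0) ?normr0//;
  apply/eqP; rewrite intr_eq0 subrr.
rewrite -add1n mean_dispD// natrD (le_trans (ler_normD _ _))// lerD//.
  rewrite -(walk_op1 vy) (le_trans (ler_norm_sum _ _ _))//; apply: ler_sum => w _.
  rewrite normrM (ger0_norm (kern_ge0 _ _ _ _)) ler_wpM2l ?kern_ge0//.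
  by rewrite -intr_norm -[leRHS]/(1%:~R) ler_int step_near.
by apply: le_trans (norm_iter_walk_op 1 vy IH) _; rewrite iter_walk_op_cst.
Qed.

Lemma mean_disp_shift n v y l : supported A v ->
  mean_disp n (shift v y) l = mean_disp n y l.
Proof.
move=> vA; rewrite /mean_disp iter_walk_op_shift//.
congr (iter _ _ _ _); apply/funext => y'.
by rewrite /= !ffunE opprD addrACA subrr addr0.
Qed.

Lemma mean_disp_forget n y l : mean_disp n (forget A y) l = mean_disp n y l.
Proof. by have [v vA yE] := shift_forget A y; rewrite [in RHS]yE mean_disp_shift. Qed.

Definition low_site k (x : {ffun 'I_d -> 'I_k} * 'I_(max_phase L)) : site d :=
  ([ffun l => (x.1 l : nat)%:Z], (x.2 : nat)).

Lemma forget_low_site k y : (0 < k)%N -> valid A y ->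
  (forall l, l \notin A -> y.1 l < k%:Z) -> exists x, forget A y = low_site (k := k) x.
Proof.
move=> k0 vy low; have [y_ge0 y2] := validP L A y vy.
have y2' : (y.2 < max_phase L)%N by apply: leq_trans y2 _; exact: leq_bigmax.
have yk l : (absz ((forget A y).1 l) < k)%N.
  by rewrite ffunE; case: ifPn => // lA; have := low l lA; have := y_ge0 l lA; lia.
exists ([ffun l => Ordinal (yk l)], Ordinal y2').
congr (_, _); apply/ffunP => l; rewrite [RHS]ffunE [in RHS]ffunE /= gez0_abs ffunE//.
by case: ifPn => // lA; exact: y_ge0.
Qed.

(* Up to a translation in the coordinates of A there are finitely many sites
   whose other coordinates are below k. *)
Lemma uniform_low k (Q : nat -> site d -> Prop) : (0 < k)%N ->
  (forall n y, Q n (forget A y) -> Q n y) ->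
  (forall y, valid A y -> exists N, forall n, (N <= n)%N -> Q n y) ->
  exists N, forall n y, (N <= n)%N -> valid A y ->
    (forall l, l \notin A -> y.1 l < k%:Z) -> Q n y.
Proof.
move=> k0 Qforget QN.
have /choice[N NP] : forall x : {ffun 'I_d -> 'I_k} * 'I_(max_phase L), exists N,
    valid A (low_site x) -> forall n, (N <= n)%N -> Q n (low_site x).
  move=> x; have [/QN[N NP]|_] := boolP (valid A (low_site x)); first by exists N.
  by exists 0%N.
exists (\max_x N x) => n y Nn vy low.
have [x xE] := forget_low_site k0 vy low.
apply: Qforget; rewrite xE; apply: NP; first by rewrite -xE valid_forget.
by apply: leq_trans Nn; exact: leq_bigmax.
Qed.

Lemma drift_uniform (a : 'I_d -> R) (eps : R) k : 0 < eps -> (0 < k)%N ->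
  is_mean_drift L A a ->
  exists N, forall n y, (N <= n)%N -> valid A y ->
    (forall l, l \notin A -> y.1 l < k%:Z) ->
    forall l, `|mean_disp n y l - n%:R * a l| < eps * n%:R.
Proof.
move=> eps0 k0 drift.
apply: (uniform_low (Q := fun n y => forall l,
  `|mean_disp n y l - n%:R * a l| < eps * n%:R)) k0 _ _.
  by move=> n y Q l; rewrite -mean_disp_forget.
move=> y vy.
have /choice[N NP] : forall l, exists N, forall n, (N <= n)%N ->
    `|mean_disp n.+1 y l - n.+1%:R * a l| < eps * n.+1%:R.
  move=> l; have := mean_disp_cvg (l := l) drift vy.
  move=> /cvgrPdist_lt/(_ _ eps0)[N _ NP]; exists N => n Nn.
  have /= := NP n.+1 (leq_trans Nn (leqnSn n)); rewrite distrC => lt_eps.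
  rewrite -ltr_pdivrMr ?ltr0n//.
  rewrite -[X in _ / X < _]ger0_norm ?ler0n// -normf_div.
  by rewrite mulrBl [n.+1%:R * _]mulrC mulfK// pnatr_eq0.
(* The successor excludes n = 0, where the strict inequality fails. *)
exists (\max_l N l).+1 => -[//|n] Nn l; apply: NP.
by apply: leq_trans (Nn : (_ <= n)%N); exact: leq_bigmax.
Qed.

End MeanDisplacement.

(** * Concatenating blocks into a mixture of drifts *)

Section DriftMixture.
Variables (R : realType) (d : nat) (L : mmrrw R d) (a : {set 'I_d} -> 'I_d -> R).
Implicit Types (A B E : {set 'I_d}) (y : site d) (c : pred (site d)) (w : {set 'I_d} -> R).

Local Notation valid := (valid (nphase L)).
Local Notation T := (walk_op L).

(* The mean displacement in n steps of the expanded chain with index A is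
   \sum_E w E * a E up to [err], where w E is the expected time spent moving with
   drift a E. *)
Definition drift_mixture A n y (lo err : R) w :=
  [/\ forall E, 0 <= w E,
      forall E, ~ (A \subset E /\ Dstable L E) -> w E = 0,
      lo <= \sum_E w E <= n%:R &
      forall l, `|mean_disp L A n y l - \sum_E w E * a E l| <= err].

Definition occupation A (c : pred (site d)) n y : R :=
  \sum_(k < n) iter k (T A) (fun y' => (c y')%:R) y.

Lemma occupation_ge0 A c n y : 0 <= occupation A c n y.
Proof. by apply: sumr_ge0 => k _; apply: iter_walk_op_ge0. Qed.

(** Among the first [m] times only time 0 is counted: a block is charged for its starting site
    alone. *)
Lemma occupation_split A c m n y : (0 < m)%N ->
  (c y)%:R + iter m (T A) (occupation A c n) y <= occupation A c (m + n) y.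
Proof.
case: m => // m _; rewrite [leRHS]/occupation big_split_ord lerD//.
  rewrite big_ord_recl lerDl; apply: sumr_ge0 => k _.
  by apply: iter_walk_op_ge0.
rewrite /occupation iter_walk_op_sum; apply: ler_sum => k _.
by rewrite -iterD.
Qed.

Variables (A : {set 'I_d}) (c : pred (site d)) (U : nat) (eps del : R).
Hypotheses (eps0 : 0 <= eps) (del01 : 0 <= del <= 1).
Hypothesis block : forall y, valid A y -> exists (m : nat) w,
  (0 < m <= U)%N /\
  drift_mixture A m y (del * (m%:R - (c y)%:R)) (eps * m%:R + (c y)%:R) w.

(** Strong induction on [n]: to one block from [y] is added the mixture for the remaining time,
    averaged over the site reached. Blocks starting in [c] cost one unit each, in total at most the
    occupation time of [c]; an incomplete last block costs at most [U]. *)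
Lemma mixture_of_blocks n y : valid A y ->
  exists w, drift_mixture A n y (del * (n%:R - U%:R - occupation A c n y))
    (eps * n%:R + U%:R + occupation A c n y) w.
Proof.
have [del0 _] := andP del01.
elim/ltn_ind: n y => n IH y vy.
have occ0 := occupation_ge0 A c n y.
have [nU|Un] := ltnP n U.
  have nUR : n%:R <= U%:R :> R by rewrite ler_nat ltnW.
  (* With no weight at all the lower bound is nonpositive, and the whole displacement is an error of
     at most [U]. *)
  exists (fun=> 0); split=> // [|l].
    rewrite big1// ler0n andbT mulr_ge0_le0//; lra.
  rewrite big1 ?subr0 => [|E _]; last by rewrite mul0r.
  apply: le_trans (mean_disp_le n l vy) _.
  have : 0 <= eps * n%:R by rewrite mulr_ge0.
  lra.
have [m [w0 [/andP[m0 mU] [w0_ge0 w0_supp /andP[w0_lo w0_hi] w0_err]]]] := block vy.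
have mn : (m <= n)%N by exact: leq_trans Un.
have [k nE] : exists k, n = (m + k)%N by exists (n - m)%N; rewrite subnKC.
have kn : (k < n)%N by rewrite nE -[X in (X < _)%N]add0n ltn_add2r.
have /choice[W WP] : forall y', exists w, valid A y' ->
    drift_mixture A k y' (del * (k%:R - U%:R - occupation A c k y'))
      (eps * k%:R + U%:R + occupation A c k y') w.
  move=> y'; have [/(IH k kn)[w wP]|_] := boolP (valid A y'); first by exists w.
  by exists (fun=> 0).
have occ_le := occupation_split A c k y m0; rewrite -nE in occ_le.
have nR : n%:R = m%:R + k%:R :> R by rewrite nE natrD.
exists (fun E => w0 E + iter m (T A) (fun y' => W y' E) y); split.
- move=> E; rewrite addr_ge0// -(iter_walk_op_cst m 0 vy).
  by apply: iter_walk_op_le => // y' vy'; have [+ _ _ _] := WP y' vy'; exact.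
- move=> E nE'; rewrite w0_supp// add0r -(iter_walk_op_cst m 0 vy).
  by apply: iter_walk_op_ext => // y' vy'; have [_ + _ _] := WP y' vy'; exact.
- rewrite big_split /= -iter_walk_op_sum nR; apply/andP; split; last first.
    rewrite lerD// -(iter_walk_op_cst m k%:R vy).
    by apply: iter_walk_op_le => // y' vy'; have [_ _ /andP[_ +] _] := WP y' vy'.
  have lo : del * (k%:R - U%:R) - del * iter m (T A) (occupation A c k) y <=
      iter m (T A) (fun y' => \sum_E W y' E) y.
    rewrite -{1}(iter_walk_op_cst m (del * (k%:R - U%:R)) vy) -iter_walk_opZ -iter_walk_opB.
    apply: iter_walk_op_le => // y' vy'; have [_ _ /andP[+ _] _] := WP y' vy'.
    by rewrite -mulrBr.
  apply: le_trans (lerD w0_lo lo); rewrite -mulrBr -mulrDr ler_wpM2l//; lra.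
move=> l; rewrite nE mean_dispD// -nE.
under eq_bigr do rewrite mulrDl.
rewrite big_split /= opprD addrACA nR mulrDr.
have -> : \sum_E iter m (T A) (fun y' => W y' E) y * a E l =
    iter m (T A) (fun y' => \sum_E W y' E * a E l) y.
  rewrite iter_walk_op_sum; apply: eq_bigr => E _; rewrite mulrC -iter_walk_opZ.
  by congr (iter _ _ _ _); apply/funext => y'; rewrite mulrC.
rewrite -iter_walk_opB.
have err : `|iter m (T A) (fun y' => mean_disp L A k y' l - \sum_E W y' E * a E l) y| <=
    eps * k%:R + U%:R + iter m (T A) (occupation A c k) y.
  rewrite -{1}(iter_walk_op_cst m (eps * k%:R + U%:R) vy) -iter_walk_opD.
  by apply: norm_iter_walk_op => // y' vy'; have [_ _ _ +] := WP y' vy'; exact.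
apply: le_trans (ler_normD _ _) _; have := w0_err l; lra.
Qed.

End DriftMixture.

(** * Time scales *)

Section Scales.
Variables (R : realType) (d : nat) (L : mmrrw R d) (a : {set 'I_d} -> 'I_d -> R).
Implicit Types (A B E : {set 'I_d}) (y : site d) (w : {set 'I_d} -> R).

Local Notation valid := (valid (nphase L)).
Local Notation T := (walk_op L).

Definition low A k : pred (site d) :=
  fun y => [forall l, (l \notin A) ==> (y.1 l < k%:Z)].

(** Low sites have finitely many projections. Each is a transient state of the induced chain, with
    bounded occupation time, or is the projection of no valid site. *)
Lemma occupation_low_bounded A k : (0 < k)%N ->
  (forall v, transient (@induced_chain R d L A) v) ->
  exists M : R, forall n y, valid A y -> occupation L A (low A k) n y <= M.
Proof.
move=> k0 trans.
have /choice[M MP] : forall x : {ffun 'I_d -> 'I_k} * 'I_(max_phase L), exists M : R,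
    forall n y, valid A y ->
    occupation L A (fun y' => forget A y' == low_site x) n y <= M.
  move=> x; have [vx|vx] :=
      boolP (valid A (low_site x) && [forall l in A, (low_site x).1 l == 0]).
    pose v : induced_state (nphase L) A := exist _ (low_site x) vx.
    have [e e0 eP] := transient_surv (trans v).
    by exists e^-1 => n y vy; apply: occupation_bound.
  exists 0 => n y vy; rewrite /occupation big1// => i _.
  rewrite -(iter_walk_op_cst i 0 vy); apply: iter_walk_op_ext => // y' vy'.
  case: eqP => // e; case/negP: vx; rewrite -e valid_forget vy'.
  by apply/forallP => l; apply/implyP => lA; rewrite ffunE lA.
exists (\sum_x M x) => n y vy.
have sumM : \sum_x occupation L A (fun y' => forget A y' == low_site (L := L) (k := k) x) n y
    <=
    \sum_x M x.
  by apply: ler_sum => x _; exact: MP.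
apply: le_trans sumM.
rewrite /occupation exchange_big; apply: ler_sum => i _.
rewrite -iter_walk_op_sum; apply: iter_walk_op_le => // y' vy'.
have [lowy'|_] := boolP (low A k y'); last exact: sumr_ge0.
have [x xE] : exists x, forget A y' = low_site (L := L) (k := k) x.
  by apply: forget_low_site => // l; exact/implyP/(forallP lowy').
by rewrite (bigD1 x)//= xE eqxx lerDl sumr_ge0.
Qed.

(** The weights are times: for E = A :|: B, the ratio [w E / n] is the coefficient of [B] in the
    statement. The last clause keeps the simpler form available for stable [A]. *)
Definition drift_estimate A n y (eps del : R) :=
  (exists w, [/\ forall E, 0 <= w E,
     forall E, ~ (A \subset E /\ Dstable L E) -> w E = 0,
     del * n%:R < \sum_E w E <= n%:R &
     forall l, `|mean_disp L A n y l - \sum_E w E * a E l| < eps * n%:R]) /\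
  (Dstable L A -> forall l, `|mean_disp L A n y l - n%:R * a A l| < eps * n%:R).

Lemma drift_estimate_weaken A n y (eps eps' del del' : R) : eps' <= eps -> del <= del' ->
  drift_estimate A n y eps' del' -> drift_estimate A n y eps del.
Proof.
move=> le_eps le_del [[w [w0 ws /andP[wlo whi] werr]] st].
have le_epsn : eps' * n%:R <= eps * n%:R by rewrite ler_wpM2r.
split; last by move=> SA l; apply: lt_le_trans (st SA l) _.
exists w; split=> // [|l]; last exact: lt_le_trans (werr l) _.
by rewrite whi andbT; apply: le_lt_trans wlo; rewrite ler_wpM2r.
Qed.

Lemma drift_estimate_stable A k (eps del : R) : 0 < eps -> del < 1 -> (0 < k)%N ->
  Dstable L A -> is_mean_drift L A (a A) ->
  exists N, forall n y, (N <= n)%N -> valid A y -> low A k y -> drift_estimate A n y eps del.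
Proof.
move=> eps0 del1 k0 SA drift.
have [N NP] := drift_uniform eps0 k0 drift.
(* The successor gives n > 0, which makes [del * n < n] strict. *)
exists N.+1 => n y Nn vy lowy.
have st l : `|mean_disp L A n y l - n%:R * a A l| < eps * n%:R.
  by apply: NP => //; [exact: ltnW|move=> l' ; exact/implyP/(forallP lowy)].
split=> //; exists (fun E => (E == A)%:R * n%:R); split.
- by move=> E; rewrite mulr_ge0.
- by move=> E nE; case: eqP => [e|_]; rewrite ?mul0r//; case: nE; rewrite e.
- rewrite (bigD1 A)//= eqxx mul1r big1 ?addr0 => [|E /negbTE ->]; last by rewrite mul0r.
  by rewrite lexx andbT gtr_pMl// ltr0n (leq_ltn_trans _ Nn).
move=> l; rewrite (bigD1 A)//= eqxx mul1r big1 ?addr0// => E /negbTE ->.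
by rewrite !mul0r.
Qed.

(** Visits to low sites and the last block cause a bounded error only, absorbed for large [n] by the
    gaps between [eps'] and [eps] and between [del] and [del']. *)
Lemma drift_estimate_transient A k U (eps eps' del del' : R) :
  0 <= eps' -> eps' < eps -> 0 < del -> del < del' -> del' <= 1 ->
  (0 < k)%N -> (0 < U)%N ->
  ~ Dstable L A -> (forall v, transient (@induced_chain R d L A) v) ->
  (forall y, valid A y -> ~~ low A k y -> exists (m : nat) w,
     (0 < m <= U)%N /\ drift_mixture L a A m y (del' * m%:R) (eps' * m%:R) w) ->
  exists N, forall n y, (N <= n)%N -> valid A y -> drift_estimate A n y eps del.
Proof.
move=> eps'0 eps'_lt del0 del_lt del'1 k0 U0 nSA trans block.
have [M MP] := occupation_low_bounded k0 trans.
have del'01 : 0 <= del' <= 1 by rewrite del'1 andbT ltW// (lt_trans del0).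
have blocks y : valid A y -> exists (m : nat) w, (0 < m <= U)%N /\
    drift_mixture L a A m y (del' * (m%:R - (low A k y)%:R))
      (eps' * m%:R + (low A k y)%:R) w.
  move=> vy; have [lowy|nlow] := boolP (low A k y).
    (* At a low site the block is a single step without weight; its displacement, at most 1, is
       charged to the visit. *)
    exists 1%N, (fun=> 0); split=> //; split=> // [|l].
      by rewrite big1// subrr mulr0 lexx ler01.
    rewrite big1 ?subr0 => [|E _]; last by rewrite mul0r.
    by apply: le_trans (mean_disp_le 1 l vy) _; rewrite lerDr mulr1.
  by have [m [w [mU wP]]] := block y vy nlow; exists m, w; rewrite subr0 addr0.
(* [C] bounds the additive error; once n > X, each gap multiplied by [n] exceeds [C]. *)
pose C := U%:R + `|M|.
have C0 : 0 <= C by rewrite addr_ge0.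
pose X := C / (del' - del) + C / (eps - eps').
have X0 : 0 <= X by rewrite addr_ge0// divr_ge0// subr_ge0 ltW.
exists (Num.bound X) => n y Nn vy; split=> //.
have Xn : X < n%:R by rewrite (lt_le_trans (archi_boundP X0))// ler_nat.
have delC : C < n%:R * (del' - del).
  rewrite -ltr_pdivrMr ?subr_gt0//; apply: le_lt_trans Xn.
  by rewrite lerDl divr_ge0// subr_ge0 ltW.
have epsC : C < n%:R * (eps - eps').
  rewrite -ltr_pdivrMr ?subr_gt0//; apply: le_lt_trans Xn.
  by rewrite lerDr divr_ge0// subr_ge0 ltW.
have occ_le : U%:R + occupation L A (low A k) n y <= C.
  by rewrite lerD2l (le_trans (MP n y vy))// ler_norm.
have [w [w0 ws /andP[wlo whi] werr]] := mixture_of_blocks eps'0 del'01 blocks n vy.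
have occ0 := occupation_ge0 L A (low A k) n y.
have U0R : 0 <= U%:R :> R by [].
exists w; split=> // [|l].
  rewrite whi andbT; apply: lt_le_trans wlo.
  have : del' * (U%:R + occupation L A (low A k) n y) <= 1 * C.
    by apply: ler_pM => //; [case/andP: del'01|exact: addr_ge0].
  lra.
by apply: le_lt_trans (werr l) _; lra.
Qed.

End Scales.

(** * Choice of the scales by descending induction on the cardinality *)

Section ScaleSequences.
Variables (R : realType) (d : nat) (L : mmrrw R d) (a : {set 'I_d} -> 'I_d -> R).
Implicit Types (A B E : {set 'I_d}) (y : site d).

Local Notation valid := (valid (nphase L)).

Lemma card_ord_set_le A : (#|A| <= d)%N.
Proof. by rewrite -[X in (_ <= X)%N]card_ord max_card. Qed.

(** [B] has maximal cardinality among the sets whose coordinates outside [A] reach the threshold for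
    their size. Since thresholds decrease with the size, a coordinate reaching the next threshold
    could be added to [B]. *)
Lemma maximal_high_face A (K : nat -> nat) y :
  (forall k k', (#|A| < k)%N -> (k < k' <= d)%N -> (K k' < K k)%N) ->
  ~~ low A (K #|A|.+1) y ->
  exists B, [/\ A \subset B, (#|A| < #|B|)%N,
    forall l, l \in B -> l \notin A -> (K #|B|)%:Z <= y.1 l &
    forall l, l \notin B -> y.1 l < (K #|B|.+1)%:Z].
Proof.
move=> K_dec /forallPn[l0]; rewrite negb_imply -leNgt => /andP[l0A Kl0].
pose Q B := [&& A \subset B, (#|A| < #|B|)%N &
  [forall l, (l \in B) ==> (l \notin A) ==> ((K #|B|)%:Z <= y.1 l)]].
have Q0 : Q (l0 |: A).
  rewrite /Q finset.subsetU1 cardsU1 l0A add1n ltnSn; apply/forallP => l.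
  apply/implyP => + ; rewrite in_setU1 => /orP[/eqP ->|lA]; first by rewrite Kl0 implybT.
  by rewrite lA.
case: (arg_maxnP (fun B : {set 'I_d} => #|B|) Q0) => B /and3P[AB cAB /forallP Bhigh] Bmax.
exists B; split=> //.
  by move=> l lB lA; have := Bhigh l; rewrite lB lA.
move=> l lB; rewrite ltNge; apply/negP => Kl.
suff Q1 : Q (l |: B) by have := Bmax _ Q1; rewrite /= cardsU1 lB add1n ltnn.
rewrite /Q (fintype.subset_trans AB (finset.subsetU1 _ _)) cardsU1 lB add1n ltnS (ltnW cAB) /=.
apply/forallP => l'; apply/implyP; rewrite in_setU1 => /orP[/eqP ->|l'B].
  by rewrite Kl implybT.
apply/implyP => l'A; have := Bhigh l'; rewrite l'B l'A /=; apply: le_trans.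
have := card_ord_set_le (l |: B); rewrite cardsU1 lB add1n => Bd.
by rewrite lez_nat ltnW// K_dec// ltnSn.
Qed.

Hypothesis L_induced : forall A : {set 'I_d}, A != finset.set0 ->
  stable (@induced_chain R d L A) \/ (forall v, transient (@induced_chain R d L A) v).
Hypothesis a_mean_drift : forall A : {set 'I_d}, Dstable L A -> is_mean_drift L A (a A).

(** In the transient case a site that is not low is high over some larger [B]. During the [u] steps
    attached to [B] the chains with indices [A] and [B] coincide, so the estimate for [B] supplies a
    block for [A]. *)
Lemma drift_estimate_low A (K u : nat -> nat) (eps del : R) :
  A != finset.set0 -> 0 < eps -> 0 < del < 1 ->
  (forall k, (#|A| < k <= d)%N -> [/\ (0 < u k < K k)%N,
     forall k', (k < k' <= d)%N -> (K k' < K k)%N &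
     forall B y, #|B| = k -> valid B y -> low B (K k.+1) y ->
       drift_estimate L a B (u k) y (eps / 2) ((1 + del) / 2)]) ->
  exists N, forall n y, (N <= n)%N -> valid A y -> low A (K #|A|.+1) y ->
    drift_estimate L a A n y eps del.
Proof.
move=> A0 eps0 /andP[del0 del1] KuP; set K0 := K #|A|.+1.
(* Nothing is assumed on [K] beyond [d], so [K0] may be 0 when #|A| = d; its successor is a positive
   threshold. *)
have lowS y : low A K0 y -> low A K0.+1 y.
  move=> /forallP H; apply/forallP => l; apply/implyP => lA.
  by have := H l; rewrite lA /= => /lt_trans; apply; rewrite ltz_nat.
have [SA|nSA] := pselect (Dstable L A).
  have [N NP] := drift_estimate_stable (k := K0.+1) eps0 del1 isT SA (a_mean_drift SA).
  by exists N => n y Nn vy /lowS; exact: NP.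
have trans : forall v, transient (@induced_chain R d L A) v.
  by have [sA|//] := L_induced A0; case: nSA.
have [N NP] : exists N, forall n y, (N <= n)%N -> valid A y -> drift_estimate L a A n y eps del.
  (* The sum bounds the length of every block and its successor is positive; the tolerances granted
     for larger sets leave the required gaps. *)
  apply: (@drift_estimate_transient R d L a A K0.+1 (\sum_(k < d.+1) u k).+1 eps (eps / 2) del
    ((1 + del) / 2)) => //; try lra.
  move=> y vy nlow.
  have [||B [AB cAB Bhigh Blow]] := @maximal_high_face A K y.
  - by move=> k k' Ak /andP[kk' k'd]; have [|_ -> //] := KuP k; rewrite ?Ak ?kk'//; lia.
  - by apply: contraNN nlow => /lowS.
  have Bd := card_ord_set_le B.
  have [|/andP[u0 uK] _ goodB] := KuP #|B|; first by rewrite cAB.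
  have Bpos l : l \in B -> l \notin A -> (u #|B|)%:Z < y.1 l.
    by move=> lB lA; apply: lt_le_trans (Bhigh l lB lA); rewrite ltz_nat.
  have vB : valid B y.
    by rewrite (valid_sub L AB)// => l lB lA; have := Bpos l lB lA; lia.
  have lowB : low B (K #|B|.+1) y.
    by apply/forallP => l; apply/implyP; exact: Blow.
  have [[w [w0 ws /andP[wlo whi] werr]] _] := goodB B y erefl vB lowB.
  exists (u #|B|), w; split.
    by rewrite u0 ltnW// ltnS (bigD1 (Ordinal (Bd : (#|B| < d.+1)%N)))//= leq_addr.
  split=> // [E nE||l].
  - by apply: ws => -[BE SE]; apply: nE; split=> //; exact: fintype.subset_trans BE.
  - by rewrite ltW.
  by rewrite /mean_disp -(iter_walk_op_sub L _ AB)// ltW// werr.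
by exists N => n y Nn vy _; exact: NP.
Qed.

(** [j] counts the cardinalities from [m] to [d]. The recursive call uses tighter tolerances,
    because the transient case at cardinality [m] loses part of them. *)
Lemma scale_sequences j m (eps del : R) : (m + j = d.+1)%N -> (0 < m)%N ->
  0 < eps -> 0 < del < 1 ->
  exists K u : nat -> nat, forall k, (m <= k <= d)%N ->
    [/\ (0 < u k < K k)%N, forall k', (k < k' <= d)%N -> (K k' < K k)%N &
        forall A y, #|A| = k -> valid A y -> low A (K k.+1) y ->
          drift_estimate L a A (u k) y eps del].
Proof.
have half_gt0 (e : R) : 0 < e -> 0 < e / 2 by move=> e0; rewrite divr_gt0.
have half_le (e : R) : 0 < e -> e / 2 <= e by move=> e0; lra.
have mid_bounds (e : R) : 0 < e < 1 -> 0 < (1 + e) / 2 < 1.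
  by move=> /andP[e0 e1]; apply/andP; split; lra.
have mid_ge (e : R) : 0 < e < 1 -> e <= (1 + e) / 2 by move=> /andP[e0 e1]; lra.
elim: j m eps del => [|j IH] m eps del mj m0 eps0 del01.
  by exists (fun=> 0%N), (fun=> 0%N) => k; lia.
have [K [u KuP]] := IH m.+1 (eps / 2) ((1 + del) / 2) (etrans (addSnnS m j) mj) isT
  (half_gt0 _ eps0) (mid_bounds _ del01).
have /choice[N NP] : forall A, exists N, #|A| = m -> forall n y, (N <= n)%N ->
    valid A y -> low A (K m.+1) y -> drift_estimate L a A n y eps del.
  move=> A; have [cA|/eqP nA] := eqVneq #|A| m; last by exists 0%N => /nA.
  have [||N NP] := @drift_estimate_low A K u eps del _ eps0 del01.
  - by rewrite -card_gt0 cA.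
  - by move=> k; rewrite cA; exact: KuP.
  by exists N => _; move: NP; rewrite cA.
(* [um] is large enough for all sets of cardinality [m] at once; [Km] exceeds [um] and every later
   threshold. *)
pose um := (\max_A N A).+1.
pose Km := (um + \sum_(k < d.+1) K k).+1.
exists (fun k => if k == m then Km else K k), (fun k => if k == m then um else u k).
move=> k /andP[mk kd]; case: eqVneq => [->|km].
  split; first by rewrite /= /Km ltnS leq_addr.
    move=> k' /andP[mk' k'd]; rewrite gtn_eqF// /Km ltnS.
    have k'S : (k' < d.+1)%N by [].
    by rewrite (bigD1 (Ordinal k'S))//= addnCA leq_addr.
  move=> A y cA vy; rewrite gtn_eqF// => lowy; apply: (NP A) => //.
  by apply: leqW; exact: leq_bigmax.
have mk' : (m < k)%N by rewrite ltn_neqAle eq_sym km.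
have [|uK Kdec goodk] := KuP k; first by rewrite mk'.
split=> //.
  by move=> k' /andP[kk' k'd]; rewrite gtn_eqF ?(ltn_trans mk')// Kdec ?kk'.
move=> A y cA vy; rewrite gtn_eqF ?(ltn_trans mk')// => lowy.
by apply: drift_estimate_weaken (goodk A y cA vy lowy); [exact: half_le|exact: mid_ge].
Qed.

End ScaleSequences.

(** * From the scales to the regions of the statement *)

(** Adjoining [A] is a bijection from the subsets of its complement onto its supersets, with inverse
    E |-> E :\: A; all other [E] contribute 0. *)
Lemma sum_DstableR (R : realType) (d : nat) (L : mmrrw R d) (A : {set 'I_d})
    (F : {set 'I_d} -> R) :
  (forall E : {set 'I_d}, ~ (A \subset E /\ Dstable L E) -> F E = 0) ->
  \sum_(B : {set 'I_d} | `[< DstableR L A B >]) F (A :|: B)%SET = \sum_E F E.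
Proof.
move=> F0; rewrite (bigID (fun E : {set 'I_d} => (A \subset E) && `[< Dstable L E >]) predT F) /=.
rewrite [X in _ + X]big1 ?addr0 => [|E /negP nE]; last first.
  by apply: F0 => -[AE SE]; apply: nE; rewrite AE; exact/asboolP.
rewrite [RHS](reindex_onto (fun B : {set 'I_d} => A :|: B)%SET
  (fun E : {set 'I_d} => E :\: A)%SET) /=; last first.
  move=> E /andP[/fintype.subsetP AE _]; apply/setP => l; rewrite !inE.
  by case: (boolP (l \in A)) => // /AE ->.
apply: eq_bigl => B; rewrite finset.subsetUl /= finset.setDUl finset.setDv finset.set0U.
apply/asboolP/andP => [[BA SB]|[/asboolP SB /eqP BA]].
  split; first exact/asboolP.
  by apply/eqP/finset.setDidPl; rewrite finset.disjoints_subset.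
by split=> //; rewrite -BA finset.setDE finset.subsetIr.
Qed.

(** If a coordinate outside [A] reached the next threshold, adding it to [A] would give a larger set
    above its threshold, since the coordinates in [A] already exceed the larger value [K #|A|]. *)
Lemma region_low (R : realType) (d : nat) (L : mmrrw R d) (K : nat -> nat)
    (A : {set 'I_d}) (y : walk_state L) :
  (forall k, (#|A| < k <= d)%N -> (K k < K #|A|)%N) ->
  y \in region (fun B => K #|B|) A -> low A (K #|A|.+1) (val y).
Proof.
move=> K_dec /andP[/forallP Ahigh /forallP Amax]; apply/forallP => l; apply/implyP => lA.
have := Amax (l |: A)%SET; rewrite cardsU1 lA add1n ltnSn /= => /forallPn[l'].
rewrite negb_imply -ltNge cardsU1 lA add1n => /andP[].
rewrite in_setU1 => /orP[/eqP -> //|l'A].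
have Ad := card_ord_set_le (l |: A)%SET; rewrite cardsU1 lA add1n in Ad.
have := Ahigh l'; rewrite l'A /= => h1 /(le_lt_trans h1); rewrite ltz_nat.
by rewrite ltnNge ltnW// K_dec// ltnSn.
Qed.

(** Whatever set the choice in [sojourn] returns, both regions exclude larger sets, so its
    cardinality is that of [A], and [u] depends on nothing else. *)
Lemma sojourn_card (R : realType) (d : nat) (L : mmrrw R d) (K u : nat -> nat)
    (A : {set 'I_d}) (y : walk_state L) : A != finset.set0 ->
  y \in region (fun B => K #|B|) A ->
  sojourn (fun B => K #|B|) (fun B => u #|B|) y = u #|A|.
Proof.
move=> A0 yA; rewrite /sojourn; case: pickP => [B /andP[_ yB]|/(_ A)]; last by rewrite A0 yA.
move: yA yB => /andP[Ahigh /forallP Amax] /andP[Bhigh /forallP Bmax].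
have := Amax B; have := Bmax A; rewrite Ahigh Bhigh !implybF -!leqNgt => AB BA.
by rewrite (@anti_leq #|A| #|B|) ?AB.
Qed.

Theorem proposition3p3 (R : realType) (d : nat) (L : mmrrw R d)
  (a : {set 'I_d} -> 'I_d -> R)
  (L_semi_irreducible : semi_irreducible (@walk_chain R d L))
  (L_induced : forall A : {set 'I_d}, A != finset.set0 ->
     stable (@induced_chain R d L A) \/ (forall v, transient (@induced_chain R d L A) v))
  (a_mean_drift : forall A : {set 'I_d}, Dstable L A -> is_mean_drift L A (a A))
  (eps delta : R) (eps_gt0 : 0 < eps) (delta_gt0 : 0 < delta)
  (delta_lt1 : delta < 1) :
  exists (K u : {set 'I_d} -> nat)
         (q : {set 'I_d} -> walk_state L -> {set 'I_d} -> R),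
  [/\ (forall A : {set 'I_d}, A != finset.set0 ->
         (0 < K A)%N /\ (0 < u A < K A)%N),
      (forall A B : {set 'I_d}, A != finset.set0 -> B != finset.set0 ->
         (#|B| < #|A|)%N -> (K A < K B)%N),
      (forall (A : {set 'I_d}) (y : walk_state L), A != finset.set0 ->
         y \in region K A -> forall B, DstableR L A B -> 0 <= q A y B) &
      forall (A : {set 'I_d}) (y : walk_state L), A != finset.set0 ->
        y \in region K A ->
        [/\ delta < \sum_(B : {set 'I_d} | `[< DstableR L A B >]) q A y B <= 1,
            (forall l, `| mean_increment K u y l / (u A)%:R
               - \sum_(B : {set 'I_d} | `[< DstableR L A B >])
                   q A y B * a ((A :|: B)%SET) l | < eps) &
            (Dstable L A -> forall l,
               `| mean_increment K u y l / (u A)%:R - a A l | < eps)]].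
Proof.
have del01 : 0 < delta < 1 by rewrite delta_gt0.
(* Starting from cardinality 1 covers all nonempty sets. *)
have [K [u KuP]] := scale_sequences L_induced a_mean_drift (add1n d) isT eps_gt0 del01.
have card_bounds (A : {set 'I_d}) : A != finset.set0 -> (0 < #|A| <= d)%N.
  by move=> A0; rewrite card_gt0 A0 card_ord_set_le.
have high (A : {set 'I_d}) (y : walk_state L) :
    A != finset.set0 -> y \in region (fun B => K #|B|) A ->
    forall l, l \in A -> l \notin finset.set0 -> (u #|A|)%:Z < (val y).1 l.
  move=> A0 /andP[/forallP Ahigh _] l lA _; have [/andP[_ uK] _ _] := KuP _ (card_bounds A A0).
  by have := Ahigh l; rewrite lA /=; apply: lt_le_trans; rewrite ltz_nat.
have goodA (A : {set 'I_d}) (y : walk_state L) : A != finset.set0 ->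
    y \in region (fun B => K #|B|) A -> drift_estimate L a A (u #|A|) (val y) eps delta.
  move=> A0 yA; have [_ Kdec goodA] := KuP _ (card_bounds A A0).
  apply: goodA => //; last exact: region_low.
  rewrite (@valid_sub _ _ L finset.set0 A) ?finset.sub0set//; first exact: valP.
  by move=> l lA l0; have := high A y A0 yA l lA l0; lia.
(* The coordinates in [A] exceed the sojourn time, so until then the walk is the expanded chain with
   index [A]. *)
have incrE (A : {set 'I_d}) (y : walk_state L) l : A != finset.set0 ->
    y \in region (fun B => K #|B|) A ->
    mean_increment (fun B => K #|B|) (fun B => u #|B|) y l =
      mean_disp L A (u #|A|) (val y) l.
  move=> A0 yA; rewrite mean_incrementE (sojourn_card u A0 yA).
  rewrite -(@iter_walk_op_sub _ _ L finset.set0 A) ?finset.sub0set//.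
  exact: high.
have upos (A : {set 'I_d}) : A != finset.set0 -> 0 < (u #|A|)%:R :> R.
  by move=> /card_bounds/KuP[/andP[u0 _] _ _]; rewrite ltr0n.
(* Choice over pairs turns the weights into a function of [A] and [y]; off the region of [A] they
   are set to 0. *)
have /choice[w wP] (Ay : {set 'I_d} * walk_state L) : exists w : {set 'I_d} -> R,
    Ay.1 != finset.set0 -> Ay.2 \in region (fun B => K #|B|) Ay.1 ->
    [/\ forall E, 0 <= w E, forall E : {set 'I_d}, ~ (Ay.1 \subset E /\ Dstable L E) -> w E = 0,
      delta * (u #|Ay.1|)%:R < \sum_E w E <= (u #|Ay.1|)%:R &
      forall l, `|mean_disp L Ay.1 (u #|Ay.1|) (val Ay.2) l - \sum_E w E * a E l| <
        eps * (u #|Ay.1|)%:R].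
  case: Ay => A y /=; have [-> |A0] := eqVneq A finset.set0; first by exists (fun=> 0).
  have [yA|_] := boolP (y \in region (fun B => K #|B|) A); last by exists (fun=> 0).
  by have [[w wP] _] := goodA A y A0 yA; exists w.
exists (fun B : {set 'I_d} => K #|B|), (fun B : {set 'I_d} => u #|B|).
(* The coefficient of [B] is the fraction of the sojourn time credited to the drift of A :|: B. *)
exists (fun (A : {set 'I_d}) (y : walk_state L) (B : {set 'I_d}) =>
  w (A, y) (A :|: B)%SET / (u #|A|)%:R); split.
- move=> A A0; have [uK _ _] := KuP _ (card_bounds A A0).
  by split=> //; case/andP: uK => _; exact: leq_trans.
- move=> A B A0 B0 BA; have [_ Kdec _] := KuP _ (card_bounds B B0).
  by apply: Kdec; rewrite BA card_ord_set_le.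
- move=> A y A0 yA B _; have [w0 _ _ _] := wP (A, y) A0 yA.
  by rewrite divr_ge0.
move=> A y A0 yA; have [w0 ws wsum werr] := wP (A, y) A0 yA.
have uA := upos A A0; split.
- rewrite -mulr_suml (sum_DstableR ws) ltr_pdivlMr// ler_pdivrMr// mul1r.
  exact: wsum.
- move=> l; rewrite (incrE A y l A0 yA).
  under eq_bigr do rewrite mulrAC.
  rewrite -mulr_suml (@sum_DstableR _ _ L A (fun E => w (A, y) E * a E l)); last first.
    by move=> E nE; rewrite ws// mul0r.
  by rewrite -mulrBl normrM normfV (gtr0_norm uA) ltr_pdivrMr.
move=> SA l; rewrite (incrE A y l A0 yA); have [_ /(_ SA l) st] := goodA A y A0 yA.
rewrite -ltr_pdivrMr// -[X in _ / X < _](gtr0_norm uA) -normf_div mulrBl in st.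
by rewrite [_ * a A l]mulrC mulfK ?gt_eqF// in st.
Qed.
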